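(* Let $(k_n)$ be a sequence fulfilling condition K, and let $X_1,X_2,\dots$ be i.i.d. random vectors drawn according to an unknown distribution $\mathbb{P}_X$ on $\mathbb{R}^d$ which fulfills condition P, with associated $d'$-dimensional manifold $M$. Let $\alpha\in(0,1)$. Consider the test of $H_0:\ \partial M=\emptyset$ versus $H_1:\ \partial M\ne\emptyset$ based on $X_1,\dots,X_n$ with rejection zone $$W_n=\left\{\Delta_{n,k_n}\ge F_{d'}^{-1}\!\left(\frac{9\alpha}{2e^3n}\right)\right\}.$$ Then, with probability one, the test has power $1$ for $n$ large enough; that is, if $\partial M\neq\emptyset$, then almost surely there exists $n_0$ such that $W_n$ occurs ($H_0$ is rejected) for all $n\ge n_0$.
   Context: Notation. $F_{d'}(t)=1-\Psi_{d'}(t)$, where $\Psi_{d'}$ is the cumulative distribution function of the $\chi^2(d')$ distribution. $\|\cdot\|$ is the Euclidean norm, $A'$ is the transpose of $A$. Manifolds $M\subset\mathbb{R}^d$ of dimension $d'\le d$ and class $\mathcal{C}^2$ are regular ($\mathcal{C}^2$ embedded) submanifolds, possibly with boundary, with the Riemannian metric inherited from $\mathbb{R}^d$; $\partial M$ is the boundary of $M$ as a manifold, and $\omega$ is the associated Riemannian volume measure on $M$. Condition P. $\mathbb{P}_X$ fulfills condition P if there exist a compact, path connected $d'$-dimensional manifold $M\subset\mathbb{R}^d$ of class $\mathcal{C}^2$ and a density function $f$ on $M$ such that: (1) $\partial M$ is either empty or of class $\mathcal{C}^2$; (2) for all $x\in M$, $f(x)\ge f_0>0$, $f$ is Lipschitz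 continuous with constant $K_f$, and for all measurable $A\subset M$, $\mathbb{P}_X(A)=\int_A f\,d\omega$. Condition K. A sequence $(k_n)$ of positive integers fulfills condition K if $k_n/n^{1/(d'+1)}\to 0$ and, moreover, $k_n/(\ln n)^4\to\infty$ when $d'>1$, and $k_n/\sqrt{n\ln n}\to+\infty$ when $d'=1$. Test statistic. The $X_i$ are row vectors. $X_{j(i)}$ denotes the $j$-th nearest neighbor of $X_i$ in the sample $X_1,\dots,X_n$. For $i=1,\dots,n$ let $r_{i,k_n}=\|X_i-X_{k_n(i)}\|$, let $\mathcal{X}_{i,k_n}$ be the $k_n\times d$ matrix with rows $X_{1(i)}-X_i,\dots,X_{k_n(i)}-X_i$, and let $\hat S_{i,k_n}=\frac1{k_n}(\mathcal{X}_{i,k_n})'\mathcal{X}_{i,k_n}$. Let $Q_{i,k_n}$ be the $d'$-dimensional space spanned by the eigenvectors of $\hat S_{i,k_n}$ associated with its $d'$ largest eigenvalues. Let $X^*_{k(i)}$ be the orthogonal projection of $X_{k(i)}-X_i$ on $Q_{i,k_n}$ and $\overline{X}_{k_n,i}=\frac1{k_n}\sum_{k=1}^{k_n}X^*_{k(i)}$. Set $$\delta_{i,k_n}=\frac{(d'+2)k_n}{r_{i,k_n}^2}\|\overline{X}_{k_n,i}\|^2,\qquad \Delta_{n,k_n}=\max_{1\le i\le n}\delta_{i,k_n}.$$ *)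

(* Defs.v *)
From HB Require Import structures.
From mathcomp Require Import all_boot all_order all_algebra.
From mathcomp Require Import all_classical all_reals all_analysis.
From mathcomp Require Import measurable_realfun.

Set Implicit Arguments.
Unset Strict Implicit.
Unset Printing Implicit Defensive.

Import Order.TTheory GRing.Theory Num.Theory.
Import numFieldTopology.Exports numFieldNormedType.Exports.

Local Open Scope classical_set_scope.
Local Open Scope ring_scope.

Notation borel_rV R d := (g_sigma_algebraType (open : set (set 'rV[R]_d))).

(* The norm of the library on ['rV[R]_d] is the sup norm, which induces the
   same topology. *)
Definition enorm (R : realType) (d : nat) (v : 'rV[R]_d) : R :=
  Num.sqrt (\sum_(i < d) v 0 i ^+ 2).

Section lebesgue_rV.
Context {R : realType}.

Definition cons_rV (m : nat) (p : R * 'rV[R]_m) : 'rV[R]_m.+1 :=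
  row_mx p.1%:M p.2 : 'rV[R]_(1 + m).

Lemma cons_rV0 (m : nat) (p : R * 'rV[R]_m) : cons_rV p 0 ord0 = p.1.
Proof.
rewrite /cons_rV (_ : ord0 = lshift m (ord0 : 'I_1)); last exact/val_inj.
by rewrite (@row_mxEl _ 1 1 m) mxE eqxx mulr1n.
Qed.

Lemma cons_rVS (m : nat) (p : R * 'rV[R]_m) (j : 'I_m) :
  cons_rV p 0 (lift ord0 j) = p.2 0 j.
Proof.
rewrite /cons_rV (_ : lift ord0 j = rshift 1 j); last exact/val_inj.
by rewrite (@row_mxEr _ 1 1 m).
Qed.

Lemma measurable_open_rV (m : nat) (A : set (borel_rV R m)) :
  open (A : set 'rV[R]_m) -> measurable A.
Proof. by move=> oA; exact: sub_sigma_algebra. Qed.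

Lemma continuous_measurable_rV (m n : nat) (f : 'rV[R]_m -> 'rV[R]_n) :
  continuous f -> measurable_fun setT (f : borel_rV R m -> borel_rV R n).
Proof.
move=> cf; apply: (@measurability _ _ (borel_rV R m) (borel_rV R n) setT f (@open 'rV[R]_n) erefl).
move=> _ [A oA <-]; rewrite setTI; apply: measurable_open_rV.
by apply: open_comp => // x _; exact: cf.
Qed.

Lemma measurable_coord_rV (m : nat) (i : 'I_m) :
  measurable_fun setT (fun v : borel_rV R m => (v : 'rV[R]_m) 0 i).
Proof.
apply: (measurability _ (RGenOpens.measurableE R)) => _ [A [a [b ->]] <-].
rewrite setTI; apply: measurable_open_rV.
apply: (@open_comp _ _ (fun v : 'rV[R]_m => v 0 i)) => [x _|].
  exact: coord_continuous.
exact: interval_open.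
Qed.

Lemma open_rat_ball (m : nat) (A : set 'rV[R]_m) : open A ->
  A = \bigcup_(q in [set q : 'rV[rat]_m * nat |
         ball (map_mx ratr q.1 : 'rV[R]_m) q.2.+1%:R^-1 `<=` A])
      ball (map_mx ratr q.1 : 'rV[R]_m) q.2.+1%:R^-1.
Proof.
move=> oA; apply/seteqP; split=> [x Ax|x [q /= qA] /qA//].
have /nbhs_ballP[e /= e0 eA] := open_nbhs_nbhs (conj oA Ax).
have [n ne] : exists n, n.+1%:R^-1 < e / 2.
  have e20 : 0 < e / 2 by rewrite divr_gt0.
  by have [n _ /(_ n (leqnn n)) ?] := near_infty_natSinv_lt (PosNum e20); exists n.
have n0 : 0 < n.+1%:R^-1 :> R by rewrite invr_gt0.
have qx (i : 'I_m) : {q : rat | ball (ratr q : R) n.+1%:R^-1 (x 0 i)}.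
  apply: cid; have [|q] := @rat_in_itvoo R (x 0 i) (x 0 i + n.+1%:R^-1).
    by rewrite ltrDl.
  rewrite in_itv/= => /andP[xq qxn]; exists q.
  rewrite /ball/= gtr0_norm ?subr_gt0//.
  by rewrite ltrBlDr addrC.
pose q := \row_i sval (qx i).
have qb : ball (map_mx ratr q : 'rV[R]_m) n.+1%:R^-1 x.
  split=> // i j; rewrite !mxE ord1; exact: (svalP (qx j)).
exists (q, n) => //= y qy; apply: eA.
apply: (@le_ball _ _ _ (n.+1%:R^-1 + n.+1%:R^-1)).
  by rewrite (splitr e) lerD// ltW.
by apply: ball_triangle qy; exact: ball_sym.
Qed.

Lemma measurable_cons_rV (m : nat) :
  measurable_fun [set: R * borel_rV R m]
    (@cons_rV m : R * borel_rV R m -> borel_rV R m.+1).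
Proof.
apply: (@measurability _ _ (R * borel_rV R m)%type (borel_rV R m.+1) setT (@cons_rV m) (@open 'rV[R]_m.+1) erefl) => _ [A oA <-].
rewrite setTI (open_rat_ball oA) preimage_bigcup.
rewrite bigcup_mkcond; apply: countable_bigcupT_measurable.
  exact: countableP.
move=> [q n] /=; case: ifPn => _ //.
have n0 : 0 < n.+1%:R^-1 :> R by rewrite invr_gt0.
pose c : 'rV[R]_m.+1 := map_mx ratr q.
rewrite (_ : _ @^-1` _ = ball (c 0 ord0) n.+1%:R^-1 `*`
   (ball (\row_(j < m) c 0 (lift ord0 j) : 'rV[R]_m) n.+1%:R^-1
      : set (borel_rV R m))).
  apply: measurableX; first exact: measurable_ball.
  by apply: measurable_open_rV; exact: ball_open.
apply/seteqP; split=> [[a v]|[a v]] /=.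
  move=> [_ H]; split; first by have := H 0 ord0; rewrite cons_rV0.
  split=> // i j; rewrite !ord1 mxE.
  by have := H 0 (lift ord0 j); rewrite cons_rVS.
move=> [H0 [_ H]]; split=> // i j; rewrite !ord1.
have [->|[j' ->]] : j = ord0 \/ exists j', j = lift ord0 j'.
  by have := unliftP ord0 j; case=> [j' ->|->]; [right; exists j'|left].
- by rewrite cons_rV0.
- by rewrite cons_rVS; have := H 0 j'; rewrite mxE.
Qed.

Section lebesgue_rVS.
Variables (m : nat) (nu : {sigma_finite_measure set (borel_rV R m) -> \bar R}).

Definition lebesgue_rVS : set (borel_rV R m.+1) -> \bar R :=
  pushforward (@lebesgue_measure R \x nu)%E
    (@cons_rV m : R * borel_rV R m -> borel_rV R m.+1).

Let lebesgue_rVS0 : lebesgue_rVS set0 = 0%E.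
Proof. by rewrite /lebesgue_rVS /pushforward preimage_set0 measure0. Qed.

Let lebesgue_rVS_ge0 A : (0 <= lebesgue_rVS A)%E.
Proof. by rewrite /lebesgue_rVS /pushforward; exact: measure_ge0. Qed.

Let lebesgue_rVS_sigma_additive : semi_sigma_additive lebesgue_rVS.
Proof.
exact: (@measure_semi_sigma_additive _ _ _
  (measure_function_pushforward__canonical__measure_function_Measure
    (@lebesgue_measure R \x nu)%E (@measurable_cons_rV m))).
Qed.

HB.instance Definition _ := isMeasure.Build _ _ _ lebesgue_rVS
  lebesgue_rVS0 lebesgue_rVS_ge0 lebesgue_rVS_sigma_additive.

Let lebesgue_rVS_sigma_finite : sigma_finite setT lebesgue_rVS.
Proof.
have /sigma_finiteP[F [FT ndF mF]] := sigma_finiteT (@lebesgue_measure R).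
have /sigma_finiteP[G [GT ndG mG]] := sigma_finiteT nu.
pose g (v : borel_rV R m.+1) : R * borel_rV R m :=
  (v 0 ord0, \row_(j < m) v 0 (lift ord0 j)).
have mg : measurable_fun setT g.
  apply/measurable_fun_pairP; split; first exact: measurable_coord_rV.
  apply: (@continuous_measurable_rV m.+1 m
    (fun v => \row_(j < m) v 0 (lift ord0 j))).
  move=> v A /nbhs_ballP[e /= e0 eA]; apply/nbhs_ballP; exists e => //= w [_ H].
  by apply: eA; split=> // i j; rewrite !mxE.
have gK : cancel (@cons_rV m) g.
  move=> [a v]; rewrite /g cons_rV0; congr (_, _).
  by apply/rowP => j; rewrite mxE cons_rVS.
exists (fun n => g @^-1` (F n `*` G n)).
  rewrite -preimage_bigcup (_ : \bigcup_i _ = setT) ?preimage_setT//.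
  apply/seteqP; split=> // -[a v] _.
  have [i _ Fa] : (\bigcup_i F i) a by rewrite -FT.
  have [j _ Gv] : (\bigcup_i G i) v by rewrite -GT.
  exists (maxn i j) => //; split => /=.
    by move: a Fa; exact/subsetPset/ndF/leq_maxl.
  by move: v Gv; exact/subsetPset/ndG/leq_maxr.
move=> n; have [mFn Foo] := mF n; have [mGn Goo] := mG n.
have mFG : measurable (F n `*` G n) by exact: measurableX.
split; first by rewrite -[X in measurable X]setTI; exact: mg.
rewrite /lebesgue_rVS /pushforward -comp_preimage.
rewrite (_ : g \o _ = id) ?preimage_id; last exact/funext.
by rewrite product_measure1E// lte_mul_pinfty// ge0_fin_numE.
Qed.

HB.instance Definition _ :=
  Measure_isSigmaFinite.Build _ _ _ lebesgue_rVS lebesgue_rVS_sigma_finite.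

End lebesgue_rVS.

Fixpoint lebesgue_rV (m : nat) :
    {sigma_finite_measure set (borel_rV R m) -> \bar R} :=
  if m is m'.+1 then lebesgue_rVS (lebesgue_rV m') else \d_((0 : 'rV[R]_0) : borel_rV R 0).

Lemma lebesgue_rV_box (m : nat) (A : 'I_m -> set R) :
  (forall i, measurable (A i)) ->
  lebesgue_rV m [set v | forall i, A i (v 0 i)] =
  (\prod_(i < m) lebesgue_measure (A i))%E.
Proof.
elim: m A => [|m IH] A mA /=.
  rewrite big_ord0 /dirac indicE (_ : _ \in _ = true)//.
  by apply/mem_set => -[].
pose B : set (borel_rV R m) := [set v | forall i, A (lift ord0 i) (v 0 i)].
have mB : measurable B.
  rewrite (_ : B = \bigcap_(i in [set: 'I_m])
      ((fun v : borel_rV R m => (v : 'rV[R]_m) 0 i) @^-1` A (lift ord0 i))).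
    apply: fin_bigcap_measurable => [|i _]; first exact: finite_finset.
    by rewrite -[X in measurable X]setTI; exact: measurable_coord_rV.
  by apply/seteqP; split=> v /= H i; [move=> _; exact: H|exact: H].
rewrite big_ord_recl -IH//.
have := product_measure1E (@lebesgue_measure R) (lebesgue_rV m) (mA ord0) mB.
apply: etrans.
rewrite /lebesgue_rVS /pushforward; congr ((_ \x _)%E _).
apply/seteqP; split=> -[a v] /= H.
  split; first by have := H ord0; rewrite cons_rV0.
  by move=> i; have := H (lift ord0 i); rewrite cons_rVS.
move=> i; have [j ->|->] := unliftP ord0 i; last by rewrite cons_rV0; case: H.
by rewrite cons_rVS; case: H.
Qed.

End lebesgue_rV.

(* [r] times continuously differentiable on the open set [O]. *)
Fixpoint cont_diff (R : realType) (m n r : nat) (f : 'rV[R]_m -> 'rV[R]_n)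
    (O : set 'rV[R]_m) : Prop :=
  if r is r'.+1 then
    (forall x, O x -> differentiable f x) /\
    (forall v, cont_diff r' ('D_v f) O)
  else forall x, O x -> {for x, continuous f}.

(* The half-space of nonnegative first coordinate; it is the one-point space
   when [m = 0]. *)
Definition halfspace (R : realType) (m : nat) : set 'rV[R]_m :=
  [set u | forall j : 'I_m, j = 0%N :> nat -> 0 <= u 0 j].
Arguments halfspace : clear implicits.

Section submanifold.
Variables (R : realType) (d m : nat).
Implicit Types (M V : set 'rV[R]_d) (O : set 'rV[R]_m).
Implicit Type phi : 'rV[R]_m -> 'rV[R]_d.

(* [phi] restricted to [O `&` halfspace] is a C^2 parametrization of the
   relatively open subset [M `&` V] of [M]: a homeomorphism that extends to a
   C^2 immersion of [O]. Interior charts are those with [O] inside the open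
   half-space. *)
Definition local_param M phi O V : Prop :=
  [/\ open O, open V, cont_diff 2 phi O,
      (forall u, O u -> injective ('d phi u))
    & phi @` (O `&` halfspace R m) = M `&` V /\
      exists2 psi : 'rV[R]_d -> 'rV[R]_m,
        {within M `&` V, continuous psi} &
        forall u, (O `&` halfspace R m) u -> psi (phi u) = u].

Definition submanifold M : Prop :=
  forall x, M x -> exists phi O V, local_param M phi O V /\ V x.

Definition mboundary M : set 'rV[R]_d :=
  [set x | exists phi O V u, [/\ local_param M phi O V,
     (O `&` halfspace R m) u, phi u = x &
     exists2 j : 'I_m, j = 0%N :> nat & u 0 j = 0]].

(* The Riemannian volume measure of [M], as a Borel measure on R^d carried by
   [M]: its density in a parametrization is the square root of the Gram
   determinant of the partial derivatives (the rows of ['J phi u]). *)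
Definition is_volume M (omega : {measure set (borel_rV R d) -> \bar R}) : Prop :=
  omega (~` M) = 0%E /\
  forall phi O V, local_param M phi O V ->
  forall A : set (borel_rV R d), measurable A ->
  omega (A `&` (M `&` V)) =
  (\int[lebesgue_rV m]_(u in (O `&` halfspace R m) `&` phi @^-1` A)
     (Num.sqrt (\det ('J phi u *m ('J phi u)^T)))%:E)%E.

End submanifold.

Definition path_connected (R : realType) (d : nat) (M : set 'rV[R]_d) : Prop :=
  forall x y, M x -> M y -> exists gamma : R -> 'rV[R]_d,
    [/\ {within `[0, 1], continuous gamma}, gamma 0 = x, gamma 1 = y
      & gamma @` `[0, 1] `<=` M].

Section conditions.
Variables (R : realType) (d d' : nat).

Definition condition_P (PX : probability (borel_rV R d) R) (M : set 'rV[R]_d)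
    : Prop :=
  [/\ compact M, path_connected M, submanifold d' M,
      mboundary d' M = set0 \/ submanifold d'.-1 (mboundary d' M)
    & exists (omega : {measure set (borel_rV R d) -> \bar R})
             (f : 'rV[R]_d -> R) (f0 Kf : R),
      [/\ is_volume d' M omega,
          (\int[omega]_(x in M) (f x)%:E = 1)%E,
          0 < f0 /\ (forall x, M x -> f0 <= f x),
          (forall x y, M x -> M y -> `|f x - f y| <= Kf * enorm (x - y))
        & forall A : set (borel_rV R d), measurable A -> A `<=` M ->
            PX A = (\int[omega]_(x in A) (f x)%:E)%E]].

Definition condition_K (k : nat -> nat) : Prop :=
  [/\ forall n, (0 < k n)%N,
      (k n)%:R / n%:R `^ (d'.+1%:R)^-1 @[n --> \oo] --> (0 : R),
      (1 < d')%N -> (k n)%:R / (ln n%:R : R) ^+ 4 @[n --> \oo] --> +oo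
    & d' = 1%N ->
      (k n)%:R / Num.sqrt (n%:R * ln n%:R : R) @[n --> \oo] --> +oo].

End conditions.

Section iid.
Context (R : realType) (dT dE : measure_display) (T : measurableType dT)
  (E : measurableType dE) (P : probability T R).

Definition independent (X : nat -> {RV P >-> E}) : Prop :=
  forall (s : seq nat) (A : nat -> set E), uniq s ->
    (forall i, measurable (A i)) ->
    P (\bigcap_(i in [set` s]) (X i @^-1` A i)) =
    (\prod_(i <- s) P (X i @^-1` A i))%E.

Definition iid (X : nat -> {RV P >-> E}) (Q : probability E R) : Prop :=
  independent X /\
  forall i (A : set E), measurable A -> distribution P (X i) A = Q A.

End iid.

Section chi2.
Context {R : realType}.
Local Notation mu := (@lebesgue_measure R).

Definition Gamma_fun (a : R) : R :=
  \int[mu]_(x in `]0, +oo[) (x `^ (a - 1) * expR (- x)).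

Definition chi2_pdf (k : nat) (x : R) : R :=
  x `^ (k%:R / 2 - 1) * expR (- x / 2) / (2 `^ (k%:R / 2) * Gamma_fun (k%:R / 2)).

Definition chi2_cdf (k : nat) (t : R) : R :=
  \int[mu]_(x in `]0, t]) chi2_pdf k x.

Definition chi2_sf (k : nat) (t : R) : R := 1 - chi2_cdf k t.

Definition chi2_sf_inv (k : nat) : R -> R :=
  'pinv_(fun=> 0) `[0, +oo[ (chi2_sf k).

End chi2.

Section statistic.
Variables (R : realType) (d d' n : nat).
Implicit Types (x : 'I_n -> 'rV[R]_d) (i : 'I_n) (s : seq 'I_n).

(* [s] lists the indices of the points other than [x i] by nondecreasing
   distance to [x i]; ties are broken arbitrarily. *)
Definition is_neighbor_order x i s : bool :=
  perm_eq s [seq j <- enum 'I_n | j != i] &&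
  sorted (fun a b => enorm (x a - x i) <= enorm (x b - x i)) s.

(* The [j.+1]-th nearest neighbor of [x i]; [x i] itself when there is none. *)
Definition neighbor x i s (j : nat) : 'rV[R]_d := x (nth i s j).

Definition knn_radius x i s (k : nat) : R := enorm (x i - neighbor x i s k.-1).

Definition knn_matrix x i s (k : nat) : 'M[R]_(k, d) :=
  \matrix_(j < k) (neighbor x i s j - x i).

Definition local_cov x i s (k : nat) : 'M[R]_d :=
  k%:R^-1 *: ((knn_matrix x i s k)^T *m knn_matrix x i s k).

(* The rows of [B] are orthonormal eigenvectors of the symmetric matrix [S]
   associated with its [d'] largest eigenvalues, counted with multiplicity. *)
Definition leading_eigenbasis (S : 'M[R]_d) (B : 'M[R]_(d', d)) : Prop :=
  exists (V : 'M[R]_d) (lam : 'rV[R]_d),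
    [/\ V *m V^T = 1%:M, V *m S = diag_mx lam *m V,
        (forall a b : 'I_d, (a <= b)%N -> lam 0 b <= lam 0 a)
      & forall (a : 'I_d') (b : 'I_d), a = b :> nat -> row a B = row b V].

(* The orthogonal projection on the span of the orthonormal rows of [B]. *)
Definition proj_rows (B : 'M[R]_(d', d)) (v : 'rV[R]_d) : 'rV[R]_d :=
  v *m B^T *m B.

Definition knn_proj_mean x i s (B : 'M[R]_(d', d)) (k : nat) : 'rV[R]_d :=
  k%:R^-1 *: \sum_(j < k) proj_rows B (neighbor x i s j - x i).

Definition delta_stat x i s (B : 'M[R]_(d', d)) (k : nat) : R :=
  (d' + 2)%:R * k%:R / knn_radius x i s k ^+ 2 *
  enorm (knn_proj_mean x i s B k) ^+ 2.

Definition Delta_stat x (s : 'I_n -> seq 'I_n) (B : 'I_n -> 'M[R]_(d', d))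
    (k : nat) : R :=
  \big[Num.max/0]_(i < n) delta_stat x i (s i) (B i) k.

Definition rejects (alpha : R) x (s : 'I_n -> seq 'I_n)
    (B : 'I_n -> 'M[R]_(d', d)) (k : nat) : Prop :=
  chi2_sf_inv d' (9 * alpha / (2 * expR 1 ^+ 3 * n%:R)) <= Delta_stat x s B k.

End statistic.

(* Main.v *)
Require Import Defs.
From HB Require Import structures.
From mathcomp Require Import all_boot all_order all_algebra.
From mathcomp Require Import all_classical all_reals all_analysis.
From mathcomp Require Import measurable_realfun lra ring zify.

Set Implicit Arguments.
Unset Strict Implicit.
Unset Printing Implicit Defensive.

Import Order.TTheory GRing.Theory Num.Theory.
Import numFieldTopology.Exports numFieldNormedType.Exports.

Local Open Scope classical_set_scope.
Local Open Scope ring_scope.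

(** If the boundary is non-empty, a single boundary point [x0] suffices to make
    the test reject. In a chart with [x0 = phi u0] the manifold occupies the side
    [0 <= u_0] of the tangent space, so the neighbors of a sample point very close
    to [x0] are, up to a small error, all on one side: their mean [ybar] relative to
    that point has size comparable to the neighborhood radius, the statistic
    [delta_i] is at least a constant times [k_n], and [k_n] outgrows the critical
    value, which is only [O(ln n)].

    Three remarks keep the argument elementary.
    - Only the behavior at [x0] matters. First-order expansion of [phi] at [u0]
      gives ([boundary_geometry]) a vector [nu], the inner conormal, with
      [<nu, x - x0> >= - eps rho] on [M] near [x0], distance at most [eps rho] of
      [x - x0] to the tangent space, mass of order [rho ^ d'] for the ball of
      radius [rho] at [x0], and mass at most [O(c rho ^ d')] for the slab
      [<nu, x - x0> < c rho] of the ball of radius [3 rho]. The bounds on the mass come from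
      comparing the Riemannian density to constants on boxes of the chart.
    - The ball radii are deterministic, [rho_n ^ d'] proportional to [k_n / n].
      Exponential tail bounds for binomial counts ([chernoff]) and the first
      Borel-Cantelli lemma show that almost surely, for all large [n], some sample
      point is within [eps rho_n] of [x0], more than [k_n] are within [rho_n], and
      at most [k_n / 4] are in the slab ([eventually_good]). Then the
      [k_n] neighbors of the first one are within [2 rho_n] of it, and at least
      three quarters of them are at height [c rho_n] along [nu], which bounds
      [ybar] from below.
    - The plane found by local principal component analysis need not be compared
      to the tangent space. Discarded eigenvalues of the local covariance are
      bounded by the mean squared distance of the neighbors to any
      [d']-dimensional space, hence are [O(eps^2 rho^2)], and they control the
      part of [ybar] lost in the projection ([pca_mean]).

    On the analytic side, [chi2_sf_inv_le] bounds the quantile by an exponential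
    Markov inequality: the tail beyond [t] is at most [exp (- t / 4)] times the
    integral of the kernel at another scale, which a dilation reduces to the same
    value of the Gamma function. *)

(** * The quantile of the chi-square distribution *)

(** An integral of a nonnegative function is a supremum over the simple functions
    below it, so that monotonicity holds without measurability; this spares the
    measurability of the density, which is only controlled on the manifold. *)
Lemma ge0_le_integral_sub dd (T : measurableType dd) (R : realType)
    (mu : {measure set T -> \bar R}) (D E : set T) (f g : T -> \bar R) :
  D `<=` E -> (forall x, D x -> 0 <= f x)%E -> (forall x, E x -> 0 <= g x)%E ->
  (forall x, D x -> f x <= g x)%E ->
  (\int[mu]_(x in D) f x <= \int[mu]_(x in E) g x)%E.
Proof.
move=> DE f0 g0 fg; rewrite !ge0_integralE//.
apply: ge_ereal_sup => _ [h /= hf <-].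
apply: ereal_sup_ubound; exists h => //= x; apply: (le_trans (hf x)).
rewrite /patch; case: ifPn => [/set_mem Dx|xD].
  by rewrite ifT ?fg// inE; exact: DE.
by case: ifPn => // /set_mem/g0.
Qed.

Section chi2_tail.
Context {R : realType}.
Local Notation mu := (@lebesgue_measure R).

Lemma lebesgue_measure_scale (c : R) (A : set R) : 0 < c -> measurable A ->
  pushforward mu ( *%R c : _ -> measurableTypeR R) A = (c^-1%:E * mu A)%E.
Proof.
move=> c0 mA.
have mc : measurable_fun setT ( *%R c : measurableTypeR R -> measurableTypeR R).
  by exact: measurable_funM.
pose nu := measure_function_pushforward__canonical__measure_function_Measure mu mc.
pose k : {nonneg R} := NngNum (ltW c0).
have -> : pushforward mu ( *%R c : _ -> measurableTypeR R) A = nu A by [].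
have -> : (mu A = mscale k nu A)%E.
  apply: lebesgue_measure_unique => //= _ [[a b]] _ <-.
  rewrite /mscale/= /pushforward.
  rewrite (_ : _ @^-1` _ = `]a / c, b / c]%classic); last first.
    apply/seteqP; split=> x /=; rewrite !in_itv/=;
      by rewrite ltr_pdivrMr// ler_pdivlMr// [x * c]mulrC.
  rewrite !lebesgue_measure_itv/= !lte_fin ltr_pM2r ?invr_gt0//.
  case: ifPn => _; rewrite ?mule0// -!EFinB -EFinM.
  by congr EFin; rewrite -mulrBl mulrC divfK// gt_eqF.
by rewrite /mscale/= muleA -EFinM mulVf ?gt_eqF// mul1e.
Qed.

Lemma ge0_integral_scale (c : R) (g : R -> R) : 0 < c ->
  measurable_fun setT g -> (forall x, 0 < x -> 0 <= g x) ->
  (\int[mu]_(x in `]0%R, +oo[) (g x)%:E =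
   c%:E * \int[mu]_(x in `]0%R, +oo[) (g (c * x))%:E)%E.
Proof.
move=> c0 mg g0.
have mc : measurable_fun setT ( *%R c : measurableTypeR R -> measurableTypeR R).
  by exact: measurable_funM.
have pre : ( *%R c @^-1` `]0, +oo[%classic = `]0, +oo[%classic :> set R).
  by apply/seteqP; split=> x /=; rewrite !in_itv/= !andbT pmulr_rgt0.
rewrite -[in RHS]pre.
rewrite -(@ge0_integral_pushforward _ _ _ (measurableTypeR R) R _ mc mu _ (EFin \o g))//=; last 2 first.
- by apply: measurable_funTS; apply/measurable_EFinP.
- by move=> y; rewrite inE/= in_itv/= andbT lee_fin => /g0.
pose k : {nonneg R} := NngNum (ltW c0).
pose nu := measure_function_pushforward__canonical__measure_function_Measure mu mc.
rewrite -[RHS](@ge0_integral_mscale _ _ R nu _ _ k (EFin \o g))//=; last 2 first.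
- by apply: measurable_funTS; apply/measurable_EFinP.
- by move=> y; rewrite /= in_itv/= andbT lee_fin => /g0.
apply: eq_measure_integral => //= A mA _.
rewrite /mscale/= lebesgue_measure_scale// muleA -EFinM divff ?gt_eqF// mul1e//.
Qed.

(** The integrand of the Gamma function at scale [s]; the chi-square density is
    proportional to the kernel at scale 2. *)
Definition gamma_kernel (a s x : R) : R := x `^ (a - 1) * expR (- x / s).

Lemma measurable_gamma_kernel a s : measurable_fun setT (gamma_kernel a s).
Proof.
apply: measurable_funM; first exact: measurable_powR.
apply: measurableT_comp => //; apply: measurable_funM => //.
Qed.

Lemma gamma_kernel_ge0 a s x : 0 <= gamma_kernel a s x.
Proof. by rewrite mulr_ge0 ?powR_ge0 ?expR_ge0. Qed.

Lemma integral_gamma_kernel (a s : R) : 0 < s ->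
  (\int[mu]_(x in `]0%R, +oo[) (gamma_kernel a s x)%:E =
   (s `^ a)%:E * \int[mu]_(x in `]0%R, +oo[) (gamma_kernel a 1 x)%:E)%E.
Proof.
move=> s0; rewrite (ge0_integral_scale s0 (measurable_gamma_kernel a s)
  (fun x _ => gamma_kernel_ge0 a s x)).
rewrite -[in RHS]ge0_integralZl//=; last 3 first.
- apply: measurable_funTS; apply/measurable_EFinP; exact: measurable_gamma_kernel.
- by move=> x _; rewrite lee_fin gamma_kernel_ge0.
- by rewrite lee_fin powR_ge0.
rewrite -ge0_integralZl//=; last 3 first.
- apply: measurable_funTS; apply/measurable_EFinP.
  apply: measurableT_comp; first exact: measurable_gamma_kernel.
  by exact: measurable_funM.
- by move=> x _; rewrite lee_fin gamma_kernel_ge0.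
- by rewrite lee_fin ltW.
apply: eq_integral => x; rewrite inE/= in_itv/= andbT => x0.
rewrite -!EFinM; congr EFin; rewrite /gamma_kernel powRM ?(ltW s0) ?(ltW x0)//.
have -> : - (s * x) / s = - x by rewrite -mulrN mulrC mulrA mulVf ?gt_eqF// mul1r.
rewrite divr1 !mulrA; congr (_ * _ * _).
have {1}-> : s = s `^ 1 by rewrite powRr1// ltW.
by rewrite -powRD ?(gt_eqF s0) ?implybT// addrC subrK.
Qed.

Lemma Gamma_fun_ge0 (a : R) : 0 <= Gamma_fun a.
Proof.
by apply: Rintegral_ge0 => x _; rewrite mulr_ge0 ?powR_ge0 ?expR_ge0.
Qed.

(** [Gamma_fun] is zero exactly when its defining integral diverges; the density is
    then zero by the convention on division, and the tail is constant. *)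
Lemma chi2_sf_Gamma0 (k : nat) (t : R) : Gamma_fun (k%:R / 2) = 0 :> R ->
  chi2_sf k t = 1.
Proof.
move=> G0; rewrite /chi2_sf /chi2_cdf.
under eq_Rintegral do rewrite /chi2_pdf G0 mulr0 invr0 mulr0.
by rewrite /Rintegral integral0/= subr0.
Qed.

(** Exponential Markov inequality: beyond [t] the kernel at scale 2 is at most
    [exp (- t / 4)] times the kernel at scale 4, and both kernels have an integral
    that is a power of the scale times the same Gamma integral. *)
Lemma chi2_sf_tail (k : nat) (t : R) : 0 <= t ->
  0 < Gamma_fun (k%:R / 2) :> R ->
  chi2_sf k t <= 2 `^ (k%:R / 2) * expR (- t / 4).
Proof.
move=> t0 G0; set a : R := k%:R / 2; set G : R := Gamma_fun a.
have GE : G = fine (\int[mu]_(x in `]0%R, +oo[) (gamma_kernel a 1 x)%:E)%E.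
  by congr fine; apply: eq_integral => x _; rewrite /gamma_kernel divr1.
have G1 : (\int[mu]_(x in `]0%R, +oo[) (gamma_kernel a 1 x)%:E = G%:E)%E.
  have : (0 <= \int[mu]_(x in `]0%R, +oo[) (gamma_kernel a 1 x)%:E)%E.
    by apply: integral_ge0 => x _; rewrite lee_fin; exact: gamma_kernel_ge0.
  move: G0; rewrite -/a -/G GE.
  by case: (integral _ _ _) => //=; rewrite ltxx.
have p0 (s : R) : 0 < s -> 0 < s `^ a by move=> ?; rewrite powR_gt0.
have D0 : 0 < 2 `^ a * G by rewrite mulr_gt0// p0.
set u := (\int[mu]_(x in `]0%R, t]) (gamma_kernel a 2 x)%:E)%E.
set v := (\int[mu]_(x in `]t, +oo[) (gamma_kernel a 2 x)%:E)%E.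
have uv : (u + v = (2 `^ a * G)%:E)%E.
  rewrite EFinM -G1 -integral_gamma_kernel// -ge0_integral_setU//=.
  - congr integral; apply/seteqP; split=> x /=; rewrite !in_itv/= ?andbT.
      by move=> [/andP[]//|]; exact: le_lt_trans.
    by move=> x0; rewrite x0/=; case: (leP x t); [left|right].
  - by apply: measurable_funTS; apply/measurable_EFinP; exact: measurable_gamma_kernel.
  - by move=> x _; rewrite lee_fin gamma_kernel_ge0.
  - apply/disj_setPS => x [] /=; rewrite !in_itv/= andbT => /andP[_ xt].
    by rewrite ltNge xt.
have u0 : (0 <= u)%E by apply: integral_ge0 => x _; rewrite lee_fin gamma_kernel_ge0.
have v0 : (0 <= v)%E by apply: integral_ge0 => x _; rewrite lee_fin gamma_kernel_ge0.
have vle : (v <= (expR (- t / 4) * (4 `^ a * G))%:E)%E.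
  rewrite EFinM [in leRHS]EFinM -G1 -integral_gamma_kernel// -ge0_integralZl//=; last 2 first.
  - by apply: measurable_funTS; apply/measurable_EFinP; exact: measurable_gamma_kernel.
  - by move=> x _; rewrite lee_fin gamma_kernel_ge0.
  apply: ge0_le_integral_sub.
  - by move=> x /=; rewrite !in_itv/= !andbT; exact: le_lt_trans.
  - by move=> x _; rewrite lee_fin gamma_kernel_ge0.
  - by move=> x _; rewrite -EFinM lee_fin mulr_ge0 ?expR_ge0 ?gamma_kernel_ge0.
  - move=> x /=; rewrite in_itv/= andbT => tx.
    rewrite -EFinM lee_fin /gamma_kernel mulrCA ler_wpM2l ?powR_ge0//.
    by rewrite -expRD ler_expR; lra.
have ufin : u \is a fin_num.
  by move: uv u0 v0; case: (u) => // ; case: (v).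
have vfin : v \is a fin_num.
  by move: uv u0 v0; case: (u) => // ; case: (v).
have cdfE : chi2_cdf k t = fine u / (2 `^ a * G).
  rewrite /chi2_cdf /Rintegral /chi2_pdf -/a -/G.
  under eq_integral do rewrite [(_ / (_ * G))%R]mulrC EFinM.
  rewrite ge0_integralZl//=; last 3 first.
  - by apply: measurable_funTS; apply/measurable_EFinP; exact: measurable_gamma_kernel.
  - by move=> x _; rewrite lee_fin; exact: gamma_kernel_ge0.
  - by rewrite lee_fin invr_ge0 ltW.
  by rewrite fineM//= mulrC.
rewrite /chi2_sf cdfE.
have -> : 1 - fine u / (2 `^ a * G) = fine v / (2 `^ a * G).
  have Dn0 : 2 `^ a * G != 0 by rewrite gt_eqF.
  apply: (mulIf Dn0); rewrite mulrBl !divfK// mul1r.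
  have /(congr1 fine) := uv; rewrite fineD//= => <-.
  by rewrite addrAC subrr add0r.
rewrite ler_pdivrMr//.
have vle' : fine v <= expR (- t / 4) * (4 `^ a * G).
  by rewrite -lee_fin fineK.
apply: (le_trans vle').
have -> : 4 = 2 * 2 :> R by rewrite -natrM.
rewrite powRM// le_eqVlt; apply/orP; left; apply/eqP; ring.
Qed.

(** The partial inverse is 0 outside the range of the tail function, and inside
    the range the exponential tail bound can be solved for the quantile. *)
Lemma chi2_sf_inv_le (k : nat) (q : R) : 0 < q < 1 ->
  chi2_sf_inv k q <= 4 * ln (2 `^ (k%:R / 2) / q).
Proof.
move=> /andP[q0 q1].
have pw : 1 <= 2 `^ (k%:R / 2) :> R.
  by rewrite -[leLHS](powRr0 2) ler_powR ?ler1n// divr_ge0.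
have rhs0 : 0 <= 4 * ln (2 `^ (k%:R / 2) / q).
  by rewrite mulr_ge0// ln_ge0// ler_pdivlMr// mul1r (le_trans _ pw)// ltW.
have [qim|qim] := pselect ((chi2_sf k @` `[0, +oo[%classic) q); last first.
  rewrite /chi2_sf_inv /pinv_ splitV.
  by rewrite (oinv_surj (fun _ => id)); case: pselect.
have /(_ _ (mem_set qim)) := @pinvK R R (fun=> 0) `[0, +oo[%classic (chi2_sf k).
rewrite -/(chi2_sf_inv k) => sfE.
set x := chi2_sf_inv k q in sfE *.
have [x0|x0] := ltP x 0; first by rewrite (le_trans (ltW x0)).
have := Gamma_fun_ge0 (k%:R / 2); rewrite le_eqVlt => /predU1P[/esym G0|G0].
  by move: q1; rewrite -sfE chi2_sf_Gamma0// ltxx.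
have := chi2_sf_tail x0 G0; rewrite sfE => qle.
rewrite -(ler_pM2l (_ : 0 < 4^-1))// mulKf//.
rewrite -ler_expR lnK ?posrE ?divr_gt0 ?(lt_le_trans _ pw)//.
rewrite ler_pdivlMr// -ler_pdivlMl ?expR_gt0// mulrC -expRN.
by rewrite (mulrC 4^-1) -mulNr.
Qed.
End chi2_tail.

(** * Binomial tails of an i.i.d. sample *)

Lemma measure_bigsetU_le dd (T : measurableType dd) (R : realType)
    (mu : {measure set T -> \bar R}) (I : Type) (s : seq I) (S : pred I)
    (F : I -> set T) : (forall i, measurable (F i)) ->
  (mu (\big[setU/set0]_(i <- s | S i) F i) <= \sum_(i <- s | S i) mu (F i))%E.
Proof.
move=> mF; pose K (U : set T) (x : \bar R) := measurable U /\ (mu U <= x)%E.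
suff [] : K (\big[setU/set0]_(i <- s | S i) F i) (\sum_(i <- s | S i) mu (F i))%E by [].
apply: (big_ind2 K) => [|U x V y [mU Ux] [mV Vy]|i _]; split=> //.
- by rewrite measure0.
- exact: measurableU.
- by apply: (le_trans (measureU2 _ _ _)) => //; exact: leeD.
Qed.

Section chernoff.
Context (R : realType) (dT dE : measure_display) (T : measurableType dT)
  (E : measurableType dE) (P : probability T R).
Variables (X : nat -> {RV P >-> E}) (Q : probability E R).
Hypothesis iidX : iid X Q.
Variables (A : set E).
Hypothesis mA : measurable A.

(** Independence is known for events only, not as a product rule for expectations:
    the law of the number of hits is therefore reached by enumerating the patterns
    of hits, each of which is an intersection of independent events. *)
Definition hits (n : nat) (w : T) : {ffun 'I_n -> bool} :=
  [ffun j : 'I_n => (X j w : E) \in A].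

Definition hit_count (n : nat) (w : T) : nat := #|[set j : 'I_n | hits n w j]%SET|.

Let p := fine (Q A).
Let q (b : bool) := if b then p else 1 - p.

Let QA : Q A = p%:E.
Proof. by rewrite /p fineK// fin_num_measure. Qed.

Let p01 : 0 <= p <= 1.
Proof. by rewrite -!lee_fin -QA measure_ge0 probability_le1. Qed.

Let side (b : bool) : set E := if b then A else ~` A.

Let sideP b x : side b x <-> (x \in A) = b.
Proof.
case: b => /=; split.
- by move=> Ax; exact: mem_set.
- by move=> /set_mem.
- by move=> Ax; exact: memNset.
- by move=> Ax /mem_set; rewrite Ax.
Qed.

Let mside b : measurable (side b).
Proof. by case: b => //=; exact: measurableC. Qed.

Let P_side i b : P (X i @^-1` side b) = (q b)%:E.
Proof.
have -> : P (X i @^-1` side b) = Q (side b).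
  by rewrite -(iidX.2 i)// /distribution /pushforward.
case: b => /=; first exact: QA.
by rewrite probability_setC// QA.
Qed.

Let mhits n (b : {ffun 'I_n -> bool}) : measurable [set w | hits n w = b].
Proof.
rewrite (_ : [set w | _] = \bigcap_(i in [set: 'I_n]) (X i @^-1` side (b i))).
  apply: fin_bigcap_measurable => [|i _]; first exact: finite_finset.
  by rewrite -[_ @^-1` _]setTI; exact: measurable_funP.
apply/seteqP; split=> w /=.
  move=> <- i _; rewrite /= ffunE.
  exact/sideP.
by move=> h; apply/ffunP => i; rewrite ffunE; exact/sideP/(h i I).
Qed.

Let P_hits n (b : {ffun 'I_n -> bool}) :
  P [set w | hits n w = b] = (\prod_(i < n) q (b i))%:E.
Proof.
pose F (i : nat) : set E := if insub i is Some j then side (b j) else setT.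
have mF i : measurable (F i) by rewrite /F; case: insubP.
have FE (i : 'I_n) : F i = side (b i) by rewrite /F valK.
have -> : [set w | hits n w = b] =
    \bigcap_(i in [set` index_iota 0 n]) (X i @^-1` F i).
  apply/seteqP; split=> w /=.
    move=> hb i; rewrite /= mem_index_iota => /andP[_ lin].
    rewrite -[i]/(val (Ordinal lin)) FE -hb ffunE.
    exact/sideP.
  move=> h; apply/ffunP => i; rewrite ffunE.
  have := h i; rewrite /= mem_index_iota ltn_ord/= FE => /(_ isT).
  by move=> /sideP.
rewrite iidX.1 ?iota_uniq// big_mkord -prodEFin.
by apply: eq_bigr => i _; rewrite FE P_side.
Qed.

Lemma measurable_hit_count n (S : pred nat) :
  measurable [set w | S (hit_count n w)].
Proof.
rewrite (_ : [set w | _] = \bigcup_(b in [set b : {ffun 'I_n -> bool} | S #|[set j | b j]%SET|]) [set w | hits n w = b]).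
  apply: fin_bigcup_measurable => [|b _]; first exact: finite_finset.
  exact: mhits.
apply/seteqP; split=> w /=; first by move=> ?; exists (hits n w).
by move=> [b /= Sb hb]; rewrite /hit_count hb.
Qed.

(** Exponential Chernoff bound for both tails: [t > 1] serves events that force
    many hits, [t < 1] events that force few. The weight [t ^ (count - m)], at least
    1 on the event, makes the sum over patterns factor over the sample. *)
Lemma chernoff n m (S : pred nat) (t : R) : 0 < t ->
  (forall c, S c -> t ^+ m <= t ^+ c) ->
  (P [set w | S (hit_count n w)] <=
   (t ^- m * expR (n%:R * fine (Q A) * (t - 1)))%:E)%E.
Proof.
move=> t0 St; rewrite -/p.
have q0 b : 0 <= q b by case/andP: p01 => ? ?; case: b => //=; rewrite subr_ge0.
rewrite (_ : [set w | _] = \big[setU/set0]_(b : {ffun 'I_n -> bool} |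
    S #|[set j | b j]%SET|) [set w | hits n w = b]); last first.
  rewrite -bigcup_seq_cond; apply/seteqP; split=> w /=.
    by move=> ?; exists (hits n w) => //=; rewrite mem_index_enum.
  by move=> [b /= /andP[_ Sb] hb]; rewrite /hit_count hb.
apply: (le_trans (measure_bigsetU_le _ _ _ (@mhits n))).
rewrite (eq_bigr (fun b : {ffun 'I_n -> bool} => (\prod_(i < n) q (b i))%:E)); last first.
  by move=> b _; exact: P_hits.
rewrite sumEFin lee_fin.
apply: (@le_trans _ _ (\sum_(b : {ffun 'I_n -> bool})
    t ^- m * \prod_(i < n) (q (b i) * t ^+ b i))).
  apply: (@le_trans _ _ (\sum_(b : {ffun 'I_n -> bool} | S #|[set j | b j]%SET|)
    t ^- m * \prod_(i < n) (q (b i) * t ^+ b i))).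
    apply: ler_sum => b Sb; rewrite big_split/= prodrXr.
    rewrite (_ : (\sum_(i < n) b i)%N = #|[set j | b j]%SET|); last first.
      rewrite -sum1_card [RHS]big_mkcond/=; apply: eq_bigr => i _.
      by rewrite inE; case: (b i).
    rewrite mulrCA ler_peMr ?prodr_ge0//.
    by rewrite ler_pdivlMl ?exprn_gt0// mulr1 St.
  rewrite [leRHS](bigID (fun b : {ffun 'I_n -> bool} => S #|[set j | b j]%SET|))/=.
  rewrite lerDl sumr_ge0// => b _.
  rewrite mulr_ge0 ?invr_ge0 ?exprn_ge0 ?(ltW t0)// prodr_ge0// => i _.
  by rewrite mulr_ge0// exprn_ge0// ltW.
rewrite -mulr_sumr ler_wpM2l ?invr_ge0 ?exprn_ge0 ?(ltW t0)//.
rewrite -(bigA_distr_bigA (fun i b => q b * t ^+ b))/=.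
rewrite prodr_const card_ord -mulrA expRM_natl.
apply: lerXn2r; rewrite ?nnegrE ?expR_ge0//.
  by apply: sumr_ge0 => b _; rewrite mulr_ge0// exprn_ge0// ltW.
apply: le_trans (expR_ge1Dx _).
rewrite big_bool/= expr1 expr0; lra.
Qed.
End chernoff.

(** * The Euclidean norm *)

Section euclid.
Context {R : realType}.

Definition dotv n (u v : 'rV[R]_n) : R := \sum_(i < n) u 0 i * v 0 i.

Lemma dotvE n (u v : 'rV[R]_n) : dotv u v = (u *m v^T) 0 0.
Proof. by rewrite mxE; apply: eq_bigr => i _; rewrite mxE. Qed.

Lemma dotvC n (u v : 'rV[R]_n) : dotv u v = dotv v u.
Proof. by apply: eq_bigr => i _; rewrite mulrC. Qed.

Lemma dotvDl n (u v w : 'rV[R]_n) : dotv (u + v) w = dotv u w + dotv v w.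
Proof. by rewrite !dotvE mulmxDl mxE. Qed.

Lemma dotvZl n a (u w : 'rV[R]_n) : dotv (a *: u) w = a * dotv u w.
Proof. by rewrite !dotvE -scalemxAl mxE. Qed.

Lemma dotvBl n (u v w : 'rV[R]_n) : dotv (u - v) w = dotv u w - dotv v w.
Proof. by rewrite !dotvE mulmxBl !mxE. Qed.

Lemma dotvDr n (u v w : 'rV[R]_n) : dotv w (u + v) = dotv w u + dotv w v.
Proof. by rewrite dotvC dotvDl !(dotvC w). Qed.

Lemma dotvZr n a (u w : 'rV[R]_n) : dotv w (a *: u) = a * dotv w u.
Proof. by rewrite dotvC dotvZl (dotvC w). Qed.

Lemma dotvBr n (u v w : 'rV[R]_n) : dotv w (u - v) = dotv w u - dotv w v.
Proof. by rewrite dotvC dotvBl !(dotvC w). Qed.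

Lemma dotv_sumr n (I : Type) (s : seq I) (F : I -> 'rV[R]_n) w :
  dotv w (\sum_(i <- s) F i) = \sum_(i <- s) dotv w (F i).
Proof.
elim/big_ind2: _ => [|_ u _ v <- <-|//]; last by rewrite dotvDr.
by rewrite /dotv big1// => i _; rewrite mxE mulr0.
Qed.

Lemma dotvv_ge0 n (u : 'rV[R]_n) : 0 <= dotv u u.
Proof. by apply: sumr_ge0 => i _; rewrite -expr2 sqr_ge0. Qed.

Lemma dotvv_eq0 n (u : 'rV[R]_n) : dotv u u = 0 -> u = 0.
Proof.
move=> /eqP; rewrite psumr_eq0 => [/allP u0|i _]; last by rewrite -expr2 sqr_ge0.
apply/rowP => i; have /= := u0 i (mem_index_enum _).
by rewrite -expr2 sqrf_eq0 mxE => /eqP.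
Qed.

Lemma enorm_sqr n (u : 'rV[R]_n) : enorm u ^+ 2 = dotv u u.
Proof.
rewrite /enorm sqr_sqrtr; first by apply: eq_bigr => i _; rewrite expr2.
by apply: sumr_ge0 => i _; rewrite sqr_ge0.
Qed.

Lemma enorm_ge0 n (u : 'rV[R]_n) : 0 <= enorm u.
Proof. exact: sqrtr_ge0. Qed.

(** Expansion of the squared norm of [(v.v) u - (u.v) v]. *)
Lemma dotv_cauchy n (u v : 'rV[R]_n) : dotv u v ^+ 2 <= dotv u u * dotv v v.
Proof.
have := dotvv_ge0 v; rewrite le_eqVlt => /predU1P[/esym v0|v0].
  have {1}-> := dotvv_eq0 v0.
  by rewrite /dotv big1 ?expr0n/= ?v0 ?mulr0// => [|i _]; rewrite ?mxE ?mulr0// -/(dotv v v) v0 mulr0.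
have := dotvv_ge0 (dotv v v *: u - dotv u v *: v).
rewrite !(dotvBl, dotvBr, dotvZl, dotvZr) (dotvC v u) => h.
rewrite -subr_ge0 -(pmulr_rge0 _ v0); apply: le_trans h _.
by rewrite le_eqVlt; apply/orP; left; apply/eqP; ring.
Qed.

Lemma dotv_le n (u v : 'rV[R]_n) : `|dotv u v| <= enorm u * enorm v.
Proof.
rewrite -[leLHS]ger0_norm// -ler_sqr ?nnegrE ?mulr_ge0 ?enorm_ge0//.
by rewrite normr_id real_normK ?num_real// exprMn !enorm_sqr dotv_cauchy.
Qed.

Lemma enormD n (u v : 'rV[R]_n) : enorm (u + v) <= enorm u + enorm v.
Proof.
rewrite -ler_sqr ?nnegrE ?addr_ge0 ?enorm_ge0// sqrrD !enorm_sqr.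
rewrite !(dotvDl, dotvDr) (dotvC v u).
have := le_trans (ler_norm _) (dotv_le u v); lra.
Qed.

Lemma enormN n (u : 'rV[R]_n) : enorm (- u) = enorm u.
Proof.
by rewrite /enorm; congr Num.sqrt; apply: eq_bigr => i _; rewrite mxE sqrrN.
Qed.

Lemma enormB n (u v : 'rV[R]_n) : enorm (u - v) <= enorm u + enorm v.
Proof. by rewrite -(enormN v) enormD. Qed.

Lemma enorm_distC n (u v : 'rV[R]_n) : enorm (u - v) = enorm (v - u).
Proof. by rewrite -enormN opprB. Qed.

Lemma enorm0 n : enorm (0 : 'rV[R]_n) = 0.
Proof.
by rewrite /enorm big1 ?sqrtr0// => i _; rewrite mxE expr0n.
Qed.

Lemma sqr_sum_le k (x : 'I_k -> R) :
  (\sum_j x j) ^+ 2 <= k%:R * \sum_j x j ^+ 2.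
Proof.
have := dotv_cauchy (\row_j x j) (const_mx 1 : 'rV[R]_k).
rewrite /dotv; under eq_bigr do rewrite !mxE mulr1.
under [X in _ <= X * _]eq_bigr do rewrite !mxE -expr2.
under [X in _ <= _ * X]eq_bigr do rewrite !mxE mulr1.
by rewrite sumr_const card_ord mulrC.
Qed.

Lemma norm_coord_le n (v : 'rV[R]_n) i : `|v 0 i| <= `|v|.
Proof.
by rewrite [leRHS]/Num.Def.normr /= mx_normrE; apply/bigmax_geP; right => /=; exists (0, i).
Qed.

Lemma norm_leP n (v : 'rV[R]_n) (r : R) : 0 <= r ->
  (forall i, `|v 0 i| <= r) -> `|v| <= r.
Proof.
move=> r0 vr; rewrite [leLHS]/Num.Def.normr /= mx_normrE.
by apply/bigmax_leP; split=> // -[j i] _ /=; rewrite ord1.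
Qed.

Lemma enorm_le_norm n (v : 'rV[R]_n) : enorm v <= n%:R * `|v|.
Proof.
rewrite -ler_sqr ?nnegrE ?mulr_ge0 ?enorm_ge0// enorm_sqr exprMn.
apply: (@le_trans _ _ (n%:R * `|v| ^+ 2)).
  rewrite mulr_natl -[X in _ *+ X]card_ord -sumr_const.
  apply: ler_sum => i _; rewrite -expr2 -real_normK ?num_real//.
  by rewrite ler_sqr ?nnegrE// norm_coord_le.
rewrite ler_wpM2r ?exprn_ge0// -natrX ler_nat.
by case: n {v} => // n; rewrite expnS expn1 leq_pmulr.
Qed.

Lemma coord_le_enorm n (v : 'rV[R]_n) i : `|v 0 i| <= enorm v.
Proof.
rewrite -ler_sqr ?nnegrE ?enorm_ge0// enorm_sqr real_normK ?num_real//.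
rewrite /dotv (bigD1 i)//= -expr2 lerDl sumr_ge0// => j _.
by rewrite -expr2 sqr_ge0.
Qed.

Lemma norm_le_enorm n (v : 'rV[R]_n) : `|v| <= enorm v.
Proof. by apply: norm_leP => [|i]; [exact: enorm_ge0|exact: coord_le_enorm]. Qed.

Lemma enorm_continuous n : continuous (@enorm R n).
Proof.
move=> u; apply: (continuous_comp _ (@sqrt_continuous R _)).
apply: (continuous_big _ (F := fun i (v : 'rV[R]_n) => v 0 i ^+ 2)) => [|i _ v].
  exact: add_continuous.
apply: (@continuous_comp _ _ _ (fun w : 'rV[R]_n => w 0 i) (fun x : R => x ^+ 2)); first exact: coord_continuous.
exact: exprn_continuous.
Qed.

Lemma dotv_continuous n (v : 'rV[R]_n) : continuous (dotv v).
Proof.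
apply: (continuous_big _ (F := fun i (w : 'rV[R]_n) => v 0 i * w 0 i)) => [|i _ w].
  exact: add_continuous.
apply: (@cvgM R _ (nbhs w) _ (cst (v 0 i)) (fun w : 'rV[R]_n => w 0 i)); [exact: cvg_cst|exact: coord_continuous].
Qed.

Lemma open_eball n (x0 : 'rV[R]_n) r : open [set x | enorm (x - x0) < r].
Proof.
pose f (x : 'rV[R]_n) := enorm (x - x0).
rewrite (_ : [set x | _] = f @^-1` [set y | y < r])//.
apply: open_comp; last exact: open_lt.
move=> x _; rewrite /f.
have cs : {for x, continuous (fun y : 'rV[R]_n => y - x0)}.
  by apply: continuousB; [move=> ?; exact: cvg_id|exact: cst_continuous].
exact: (continuous_comp cs (@enorm_continuous n _)).
Qed.

Lemma open_halfplane n (x0 v : 'rV[R]_n) r : open [set x | dotv v (x - x0) < r].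
Proof.
pose f (x : 'rV[R]_n) := dotv v (x - x0).
rewrite (_ : [set x | _] = f @^-1` [set y | y < r])//.
apply: open_comp; last exact: open_lt.
move=> x _; rewrite /f.
have cs : {for x, continuous (fun y : 'rV[R]_n => y - x0)}.
  by apply: continuousB; [move=> ?; exact: cvg_id|exact: cst_continuous].
exact: (continuous_comp cs (@dotv_continuous n v _)).
Qed.

Lemma enormZ n (a : R) (u : 'rV[R]_n) : enorm (a *: u) = `|a| * enorm u.
Proof.
apply/eqP; rewrite -(@eqrXn2 _ 2) ?mulr_ge0 ?enorm_ge0//.
by rewrite exprMn !enorm_sqr dotvZl dotvZr mulrA real_normK ?num_real// expr2.
Qed.

Lemma enorm_sum n (I : Type) (s : seq I) (F : I -> 'rV[R]_n) :
  enorm (\sum_(i <- s) F i) <= \sum_(i <- s) enorm (F i).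
Proof.
elim/big_ind2: _ => [|a u b v ua vb|//]; first by rewrite enorm0.
exact: le_trans (enormD _ _) (lerD ua vb).
Qed.

Lemma enorm_mulmx_le m n (h : 'rV[R]_m) (J : 'M[R]_(m, n)) :
  enorm (h *m J) <= (\sum_i enorm (row i J)) * `|h|.
Proof.
rewrite mulmx_sum_row (le_trans (enorm_sum _ _))// mulr_suml.
apply: ler_sum => i _; rewrite enormZ mulrC ler_wpM2l ?enorm_ge0//.
exact: norm_coord_le.
Qed.

End euclid.

(** * Principal components of a nearly flat cloud *)

Section pca.
Context {R : realType} (d m k : nat).
Variables (Y : 'M[R]_(k, d)) (J : 'M[R]_(m, d)) (B : 'M[R]_(m, d)) (e : R).
Hypotheses (k0 : (0 < k)%N) (md : (m <= d)%N).
Hypothesis Yflat : forall j : 'I_k, exists h : 'rV[R]_m, enorm (row j Y - h *m J) <= e.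
Local Notation S := (k%:R^-1 *: (Y^T *m Y)).
Hypothesis hB : leading_eigenbasis S B.
Local Notation ybar := (k%:R^-1 *: \sum_j row j Y).

Let kR : 0 < k%:R :> R. Proof. by rewrite ltr0n. Qed.

Let quad_cov (w : 'rV[R]_d) :
  dotv (w *m S) w = k%:R^-1 * \sum_j dotv (row j Y) w ^+ 2.
Proof.
rewrite -scalemxAr dotvZl; congr (_ * _).
have -> : dotv (w *m (Y^T *m Y)) w = dotv (w *m Y^T) (w *m Y^T).
  by rewrite !dotvE trmx_mul trmxK !mulmxA.
apply: eq_bigr => j _; rewrite -expr2; congr (_ ^+ 2).
by rewrite mxE; apply: eq_bigr => i _; rewrite !mxE mulrC.
Qed.

(** Courant-Fischer: the first [a + 1] eigenvectors span a space of dimension larger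
    than [m], which contains a unit vector orthogonal to the rows of [J]. Along that
    vector the cloud has second moment at most [e ^ 2], while the quadratic form of
    [S] is at least [lam 0 a] on all unit vectors of the span. *)
Lemma residual_eigenvalue_le (V : 'M[R]_d) (lam : 'rV[R]_d) (a : 'I_d) :
  V *m V^T = 1%:M -> V *m S = diag_mx lam *m V ->
  (forall a b : 'I_d, (a <= b)%N -> lam 0 b <= lam 0 a) ->
  (m <= a)%N -> lam 0 a <= e ^+ 2.
Proof.
move=> VV VS lam_dec ma.
have a_lt : (a.+1 <= d)%N by [].
pose V1 : 'M[R]_(a.+1, d) := rowsub (widen_ord a_lt) V.
have V1V1 : V1 *m V1^T = 1%:M.
  apply/matrixP => i j; have /matrixP/(_ (widen_ord a_lt i) (widen_ord a_lt j)) := VV.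
  rewrite !mxE => h; rewrite -[RHS]h; apply: eq_bigr => l _; by rewrite !mxE.
have [z z0 zJ] : exists2 z : 'rV[R]_a.+1, z != 0 & z *m (V1 *m J^T) = 0.
  have /rowV0Pn[z zk z0] : kermx (V1 *m J^T) != 0.
    rewrite -mxrank_eq0 mxrank_ker -lt0n subn_gt0.
    by rewrite (leq_ltn_trans (rank_leq_col _)).
  by exists z => //; exact/sub_kermxP.
pose w := z *m V1.
have ww : dotv w w = dotv z z.
  by rewrite !dotvE /w trmx_mul mulmxA -(mulmxA z) V1V1 mulmx1.
have zz0 : 0 < dotv z z.
  rewrite lt_neqAle dotvv_ge0 andbT eq_sym; apply/eqP => /dotvv_eq0 /eqP.
  by rewrite (negbTE z0).
have up : dotv (w *m S) w <= e ^+ 2 * dotv z z.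
  rewrite quad_cov ler_pdivrMl//.
  apply: (@le_trans _ _ (\sum_(j < k) e ^+ 2 * dotv z z)).
    apply: ler_sum => j _; have [h hle] := Yflat j.
    have -> : dotv (row j Y) w = dotv (row j Y - h *m J) w.
      rewrite dotvBl [X in _ = _ - X](_ : _ = 0) ?subr0//.
      rewrite dotvC dotvE trmx_mul mulmxA /w -(mulmxA z) zJ.
      by rewrite mul0mx mxE.
    apply: (le_trans (dotv_cauchy _ _)); rewrite ww ler_wpM2r ?(ltW zz0)//.
    rewrite -enorm_sqr ler_sqr ?nnegrE ?enorm_ge0//.
    exact: le_trans (enorm_ge0 _) hle.
  by rewrite sumr_const card_ord mulr_natl.
have V1S : V1 *m S = diag_mx (colsub (widen_ord a_lt) lam) *m V1.
  apply/row_matrixP => i; rewrite row_mul.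
  have -> : row i V1 = row (widen_ord a_lt i) V by apply/rowP => j; rewrite !mxE.
  rewrite -row_mul VS; apply/rowP => j.
  by rewrite mxE mul_diag_mx [RHS]mxE mul_diag_mx !mxE.
have low : lam 0 a * dotv z z <= dotv (w *m S) w.
  rewrite /w -mulmxA V1S [dotv (z *m _) _]dotvE trmx_mul !mulmxA -(mulmxA _ V1) V1V1 mulmx1.
  rewrite -dotvE /dotv mulr_sumr; apply: ler_sum => i _.
  rewrite mul_mx_diag !mxE mulrAC -expr2 [leRHS]mulrC ler_wpM2r ?sqr_ge0//.
  by apply: lam_dec; rewrite /= -ltnS.
by rewrite -(ler_pM2r zz0) (le_trans low).
Qed.

(** The squared coordinate of the mean along an eigenvector is at most the
    eigenvalue, by convexity of the square; the projection loses only coordinates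
    along eigenvectors whose eigenvalue is at most [e ^ 2]. *)
Lemma pca_mean :
  enorm ybar ^+ 2 - d%:R * e ^+ 2 <= enorm (proj_rows B ybar) ^+ 2.
Proof.
have [V [lam [VV VS lam_dec BV]]] := hB.
have VV' : V^T *m V = 1%:M by exact: mulmx1C.
pose c := ybar *m V^T.
have BE : B = rowsub (widen_ord md) V.
  apply/row_matrixP => i; rewrite (BV i (widen_ord md i) erefl).
  by apply/rowP => j; rewrite !mxE.
have BB : B *m B^T = 1%:M.
  apply/matrixP => i j; have /matrixP/(_ (widen_ord md i) (widen_ord md j)) := VV.
  rewrite !mxE BE => h; rewrite -[RHS]h; apply: eq_bigr => l _; by rewrite !mxE.
have -> : enorm (proj_rows B ybar) ^+ 2 = \sum_(i < m) c 0 (widen_ord md i) ^+ 2.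
  rewrite enorm_sqr dotvE /proj_rows !trmx_mul trmxK -!mulmxA (mulmxA B B^T) BB.
  rewrite mul1mx mulmxA -{2}[B]trmxK -trmx_mul -dotvE.
  apply: eq_bigr => i _; rewrite -expr2; congr (_ ^+ 2).
  by rewrite /c BE !mxE; apply: eq_bigr => l _; rewrite !mxE.
have -> : enorm ybar ^+ 2 = \sum_(a < d) c 0 a ^+ 2.
  rewrite enorm_sqr -[dotv ybar ybar](_ : dotv c c = _).
    by apply: eq_bigr => i _; rewrite expr2.
  by rewrite !dotvE /c trmx_mul trmxK mulmxA -(mulmxA ybar) VV' mulmx1.
have clam a : c 0 a ^+ 2 <= lam 0 a.
  have -> : lam 0 a = dotv (row a V *m S) (row a V).
    have VVa : dotv (row a V) (row a V) = 1.
      have /matrixP/(_ a a) := VV; rewrite !mxE eqxx mulr1n => VVa.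
      by rewrite -[RHS]VVa; apply: eq_bigr => j _; rewrite !mxE.
    have -> : row a V *m S = lam 0 a *: row a V.
      by rewrite -row_mul VS; apply/rowP => j; rewrite mxE mul_diag_mx !mxE.
    by rewrite dotvZl VVa mulr1.
  have -> : c 0 a = k%:R^-1 * \sum_j dotv (row j Y) (row a V).
    under eq_bigr do rewrite dotvC.
    rewrite -dotv_sumr -dotvZr /c mxE.
    by apply: eq_bigr => j _; rewrite !mxE mulrC.
  rewrite quad_cov exprMn expr2 -mulrA ler_pM2l ?invr_gt0//.
  by rewrite ler_pdivrMl// sqr_sum_le.
rewrite lerBlDr.
rewrite (bigID (fun a : 'I_d => (a < m)%N))/=.
have -> : \sum_(a < d | (a < m)%N) c 0 a ^+ 2 = \sum_(i < m) c 0 (widen_ord md i) ^+ 2.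
  by rewrite (big_ord_narrow md).
rewrite lerD2l; apply: (@le_trans _ _ (\sum_(a < d) e ^+ 2)).
  rewrite [leLHS]big_mkcond; apply: ler_sum => a _; case: ifPn => [|_]; last exact: sqr_ge0.
  rewrite -leqNgt => ma; apply: (le_trans (clam a)).
  exact: (residual_eigenvalue_le VV VS lam_dec).
by rewrite sumr_const card_ord mulr_natl.
Qed.
End pca.

(** * Gram determinants and first-order expansion *)

Section gram.
Context {R : realType}.

(** The characteristic polynomial of [- J J^T] has value [\det (J J^T)] at 0 and is
    positive far to the right; a nonpositive value at 0 would give it a root
    [t >= 0], an eigenvalue of a negative definite matrix. *)
Lemma gram_det_gt0 m d (J : 'M[R]_(m, d)) : row_free J -> 0 < \det (J *m J^T).
Proof.
move=> freeJ; rewrite ltNge; apply/negP => det_le0.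
pose G := J *m J^T; pose p := char_poly (- G).
have p0 : p.[0] <= 0.
  have -> : p.[0] = \det G; last by [].
  rewrite /p /char_poly -horner_evalE -det_map_mx /=; congr (\det _).
  apply/matrixP => i j; rewrite !mxE /= horner_evalE.
  by rewrite !hornerE hornerMn hornerX mul0rn add0r opprK.
have [b pb] := monic_Cauchy_bound (char_poly_monic (- G)).
pose t1 := Num.max 0 b.
have t10 : 0 <= t1 by rewrite le_max lexx.
have pt1 : 0 <= p.[t1] by rewrite ltW// pb// le_max lexx orbT.
have [|t /andP[t0 _] rt] := @poly_ivt R p 0 t1 t10; first by rewrite p0 pt1.
have : eigenvalue (- G) t by rewrite eigenvalue_root_char.
move=> /eigenvalueP[v vG v0].
have vv : 0 < dotv v v.
  rewrite lt_neqAle dotvv_ge0 andbT eq_sym; apply/eqP => /dotvv_eq0 /eqP.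
  by rewrite (negbTE v0).
have vGv : dotv (v *m - G) v = - dotv (v *m J) (v *m J).
  by rewrite mulmxN -scaleN1r dotvZl mulN1r !dotvE trmx_mul !mulmxA.
have : t * dotv v v + dotv (v *m J) (v *m J) = 0.
  by rewrite -dotvZl -vG vGv addNr.
have tv : 0 <= t * dotv v v by rewrite mulr_ge0// ltW.
move/eqP; rewrite paddr_eq0 ?dotvv_ge0// => /andP[_ /eqP/dotvv_eq0 vJ].
by move: v0; rewrite -(mulmx_free_eq0 v freeJ) vJ eqxx.
Qed.

Lemma cvg_det (T : Type) (F : set_system T) (FF : Filter F) n
    (A : T -> 'M[R]_n) (A0 : 'M[R]_n) :
  (forall i j, A x i j @[x --> F] --> A0 i j) ->
  \det (A x) @[x --> F] --> \det A0.
Proof.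
move=> AF; rewrite /determinant.
apply: cvg_big => [|s _]; first exact: add_continuous.
apply: cvgM; first exact: cvg_cst.
by apply: cvg_big => [|i _]; [exact: mul_continuous| exact: AF].
Qed.

Lemma cvg_gram_det (T : Type) (F : set_system T) (FF : Filter F) m n
    (A : T -> 'M[R]_(m, n)) (A0 : 'M[R]_(m, n)) :
  (forall i j, A x i j @[x --> F] --> A0 i j) ->
  \det (A x *m (A x)^T) @[x --> F] --> \det (A0 *m A0^T).
Proof.
move=> AF; apply: cvg_det => i j; rewrite mxE; under eq_cvg do rewrite mxE.
apply: cvg_big => [|l _]; first exact: add_continuous.
under eq_cvg do rewrite mxE.
by rewrite mxE; exact: (cvgM (AF i l) (AF j l)).
Qed.

Lemma cvg_sqrt_bounds (T : Type) (F : set_system T) (FF : Filter F)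
    (h : T -> R) (D : R) : 0 < D -> h x @[x --> F] --> D ->
  \forall x \near F, Num.sqrt (D / 2) <= Num.sqrt (h x) <= Num.sqrt (D * 2).
Proof.
move=> D0 /cvgrPdist_lt/(_ (D / 2)); rewrite divr_gt0// => /(_ isT).
apply: filterS => u; rewrite ltr_norml => /andP[l1 l2].
by rewrite !ler_wsqrtr//; lra.
Qed.

Lemma differentiable_jacobian_approx m n (phi : 'rV[R]_m -> 'rV[R]_n) u0 (e : R) :
  differentiable phi u0 -> 0 < e ->
  \forall u \near u0, enorm (phi u - phi u0 - (u - u0) *m 'J phi u0) <= e * `|u - u0|.
Proof.
move=> df e0.
have e1 : 0 < e / n.+1%:R by rewrite divr_gt0.
have /eqaddoP : phi = (fun u => phi u0 + 'd phi u0 (u - u0)) +o_u0 (fun u => u - u0).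
  by apply/funext => u; have := diffE df u; rewrite lim_id.
move=> /(_ _ e1); apply: filter_app; near=> u.
rewrite /= !fctE -(mul_rV_lin1 ('d phi u0)) -/(jacobian phi u0) opprD addrA => h.
apply: (le_trans (enorm_le_norm _)).
apply: le_trans (ler_wpM2l _ h) _ => //.
rewrite mulrA ler_wpM2r// mulrCA ger_pMr// ler_pdivrMr// mul1r ler_nat.
exact: leqnSn.
Unshelve. all: by end_near. Qed.

End gram.

(** * A chart around a point *)

Section chart.
Context {R : realType} (d m : nat).
Variables (M : set 'rV[R]_d) (phi : 'rV[R]_m -> 'rV[R]_d)
  (O : set 'rV[R]_m) (V : set 'rV[R]_d) (u0 : 'rV[R]_m).
Hypothesis chart : local_param M phi O V.
Hypothesis u0dom : (O `&` halfspace R m) u0.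
Local Notation J := ('J phi u0).
Local Notation x0 := (phi u0).
Local Notation OH := (O `&` halfspace R m).

Let nearO : \forall u \near u0, O u.
Proof. by apply: open_nbhs_nbhs; split; [case: chart|case: u0dom]. Qed.

Let dphi u : O u -> differentiable phi u.
Proof. by case: chart => _ _ [/= h _] _ _; exact: h. Qed.

Let dphi0 : differentiable phi u0.
Proof. by apply: dphi; case: u0dom. Qed.

Lemma jacobian_row_free : row_free J.
Proof.
apply: inj_row_free => v vJ.
have inj : injective ('d phi u0) by case: chart => _ _ _ h _; apply: h; case: u0dom.
by apply: inj; rewrite linear0 -mul_rV_lin1.
Qed.

Lemma gram_det_cvg :
  \det ('J phi u *m ('J phi u)^T) @[u --> u0] --> \det (J *m J^T).
Proof.
have Jcvg i l : ('J phi u) i l @[u --> u0] --> J i l.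
  have DE u : O u -> ('J phi u) i l = ('D_(delta_mx 0 i) phi u) 0 l.
    by move=> Ou; rewrite deriveEjacobian; [rewrite -rowE [RHS]mxE|exact: dphi].
  have Ou0 : O u0 by case: u0dom.
  have E0 := DE u0 Ou0.
  suff : ('J phi u) i l @[u --> u0] --> ('D_(delta_mx 0 i) phi u0) 0 l by rewrite -E0.
  have Dc : {for u0, continuous ('D_(delta_mx 0 i) phi)}.
    apply: differentiable_continuous.
    by case: chart => _ _ [_ /(_ (delta_mx 0 i)) [/= h _]] _ _; apply: h; case: u0dom.
  have Dc' := continuous_comp Dc (@coord_continuous R 1 d 0 l _).
  apply: cvg_trans Dc'; apply: (@near_eq_cvg _ _ (nbhs u0)).
  by apply: filterS nearO => u Ou; rewrite /= DE.
exact: (@cvg_gram_det R _ (nbhs u0) (nbhs_filter u0) m d (fun u => 'J phi u) J Jcvg).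
Qed.

Lemma volume_density_bounds : exists g0 g1 : R, [/\ 0 < g0, 0 < g1 &
  \forall u \near u0, g0 <= Num.sqrt (\det ('J phi u *m ('J phi u)^T)) <= g1].
Proof.
have D0 := gram_det_gt0 jacobian_row_free.
exists (Num.sqrt (\det (J *m J^T) / 2)), (Num.sqrt (\det (J *m J^T) * 2)).
split; [by rewrite sqrtr_gt0 divr_gt0|by rewrite sqrtr_gt0 mulr_gt0|].
exact: (cvg_sqrt_bounds (nbhs_filter u0) D0 gram_det_cvg).
Qed.

(** A right inverse of the Jacobian recovers the coordinates of a tangent vector. *)
Lemma immersion_lower_bound : exists2 C : R, 0 < C & forall h : 'rV[R]_m,
  `|h| <= C * enorm (h *m J).
Proof.
have /row_freeP[K JK] := jacobian_row_free.
exists (1 + \sum_j enorm (col j K)^T).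
  by rewrite ltr_pwDl// sumr_ge0// => j _; exact: enorm_ge0.
move=> h; apply: norm_leP => [|i].
  by rewrite mulr_ge0 ?enorm_ge0// addr_ge0// sumr_ge0// => j _; exact: enorm_ge0.
have -> : h 0 i = dotv (h *m J) (col i K)^T.
  by rewrite dotvE trmxK colE mulmxA -(mulmxA h) JK mulmx1 -colE mxE.
apply: (le_trans (dotv_le _ _)); rewrite mulrC ler_wpM2r ?enorm_ge0//.
rewrite (bigD1 i)//= addrCA lerDl addr_ge0// sumr_ge0// => j _; exact: enorm_ge0.
Qed.

(** Continuity of the inverse chart excludes that the manifold returns close to
    [phi u0] with parameters far from [u0]. *)
Lemma chart_near (Q : 'rV[R]_m -> Prop) : (\forall u \near u0, Q u) ->
  exists2 delta : R, 0 < delta &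
    (forall x, M x -> enorm (x - x0) < delta -> V x /\ exists2 u, OH u & phi u = x) /\
    (forall u, OH u -> enorm (phi u - x0) < delta -> Q u).
Proof.
move=> nQ.
case: chart => _ openV _ _ [phiOH [psi psic psiK]].
have MVx0 : (M `&` V) x0 by rewrite -phiOH; exists u0.
have nV : \forall x \near x0, V x.
  by apply: open_nbhs_nbhs; split=> //; case: MVx0.
have npsi : \forall x \near x0, (M `&` V) x -> Q (psi x).
  have psix0 : psi x0 = u0 by exact: psiK.
  have /subspace_continuousP/(_ _ MVx0) hc := psic.
  have : nbhs (psi x0) Q by rewrite psix0.
  by move=> /hc.
have /nbhs_ballP[e /= e0 he] : nbhs x0 ([set x | V x] `&` [set x | (M `&` V) x -> Q (psi x)]).
  exact: filterI.
have sub x : enorm (x - x0) < e -> ball x0 e x.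
  move=> xe; rewrite -ball_normE /= -normrN opprB; apply: le_lt_trans xe.
  exact: norm_le_enorm.
exists e => //; split=> [x Mx /sub/he [/= Vx _]|u uOH /sub/he [/= Vx]].
  split=> //; have [u uOH ux] : (phi @` (O `&` halfspace R m)) x by rewrite phiOH.
  by exists u.
have MVu : (M `&` V) (phi u) by rewrite -phiOH; exists u.
by move=> /(_ MVu); rewrite psiK.
Qed.

(** The constant [C] is chosen before [e] and [Q], so that the size of parameter
    boxes does not depend on the precision asked of the expansion. *)
Lemma chart_approx : exists2 C : R, 0 < C &
  forall (e : R) (Q : 'rV[R]_m -> Prop), 0 < e -> (\forall u \near u0, Q u) ->
  exists2 delta : R, 0 < delta &
    (forall x, M x -> enorm (x - x0) < delta -> V x /\ exists2 u, OH u & phi u = x) /\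
    (forall u, OH u -> enorm (phi u - x0) < delta ->
      [/\ Q u, `|u - u0| <= C * enorm (phi u - x0) &
       enorm (phi u - x0 - (u - u0) *m J) <= e * enorm (phi u - x0)]).
Proof.
have [C C0 hC] := immersion_lower_bound.
exists (2 * C); first by rewrite mulr_gt0.
move=> e Q e0 nQ.
pose e1 := Num.min ((2 * C)^-1) (e / (2 * C)).
have e10 : 0 < e1 by rewrite lt_min invr_gt0 ?divr_gt0 ?mulr_gt0.
have nA := differentiable_jacobian_approx dphi0 e10.
have [delta delta0 [h1 h2]] := chart_near (filterI nQ nA).
exists delta => //; split=> // u uOH ud; have [Qu] := h2 u uOH ud.
rewrite -/J -/x0 => hu.
set a := `|u - u0| in hu *; set b := enorm (phi u - x0).
set r := enorm _ in hu.
have aC : a <= C * (b + r).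
  apply: (le_trans (hC _)); rewrite ler_wpM2l ?(ltW C0)//.
  have -> : (u - u0) *m J = (phi u - x0) - (phi u - x0 - (u - u0) *m J) by rewrite subKr.
  exact: enormB.
have a0 : 0 <= a by exact: normr_ge0.
have ra : r <= (2 * C)^-1 * a.
  by apply: (le_trans hu); rewrite ler_wpM2r// ge_min lexx.
have aC2 : a <= 2 * C * b.
  have : C * r <= 2^-1 * a.
    by apply: le_trans (ler_wpM2l (ltW C0) ra) _; rewrite invfM mulrA mulrCA divff ?gt_eqF// mulr1.
  by lra.
split=> //.
apply: (@le_trans _ _ (e / (2 * C) * a)).
  by apply: (le_trans hu); rewrite ler_wpM2r// ge_min lexx orbT.
rewrite -mulrA ler_wpM2l ?(ltW e0)// ler_pdivrMl ?mulr_gt0//.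
Qed.
End chart.

(** * Mass of small sets around a boundary point *)

Section boxes.
Context {R : realType}.

Definition box n (a b : 'rV[R]_n) : set 'rV[R]_n :=
  [set v | forall i, `[a 0 i, b 0 i]%classic (v 0 i)].

Lemma measurable_box n (a b : 'rV[R]_n) : measurable (box a b : set (borel_rV R n)).
Proof.
rewrite (_ : box a b = \bigcap_(i in [set: 'I_n])
    ((fun v : borel_rV R n => (v : 'rV[R]_n) 0 i) @^-1` `[a 0 i, b 0 i]%classic)).
  apply: fin_bigcap_measurable => [|i _]; first exact: finite_finset.
  by rewrite -[X in measurable X]setTI; exact: measurable_coord_rV.
by apply/seteqP; split=> v /= H i; [move=> _; exact: H|exact: H].
Qed.

Lemma lebesgue_box n (a b : 'rV[R]_n) : (forall i, a 0 i <= b 0 i) ->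
  lebesgue_rV n (box a b) = (\prod_i (b 0 i - a 0 i))%:E.
Proof.
move=> ab.
have := @lebesgue_rV_box R n (fun i => `[a 0 i, b 0 i]%classic) (fun i => measurable_itv _).
rewrite -/(box a b) => ->; rewrite -prodEFin; apply: eq_bigr => i _.
rewrite lebesgue_measure_itv/= lte_fin; case: ltP => // ba.
have -> : b 0 i = a 0 i by apply/eqP; rewrite eq_le ba ab.
by rewrite subrr.
Qed.

Lemma integral_box_cst n (a b : 'rV[R]_n) (c : R) : (forall i, a 0 i <= b 0 i) ->
  (\int[lebesgue_rV n]_(u in box a b) (cst c%:E u) =
   (c * \prod_i (b 0 i - a 0 i))%:E)%E.
Proof.
move=> ab; rewrite integral_cst; last exact: measurable_box.
by rewrite EFinM; congr (_ * _)%E; exact: lebesgue_box.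
Qed.

Lemma measurable_compact_rV n (M : set 'rV[R]_n) :
  compact M -> measurable (M : set (borel_rV R n)).
Proof.
move=> cM; rewrite -(setCK M); apply: measurableC; apply: measurable_open_rV.
by apply: closed_openC; apply: compact_closed => //; exact: norm_hausdorff.
Qed.

End boxes.

Section mass.
Context {R : realType} (d m : nat).
Variables (M : set 'rV[R]_d) (phi : 'rV[R]_m -> 'rV[R]_d)
  (O : set 'rV[R]_m) (V : set 'rV[R]_d) (u0 : 'rV[R]_m).
Hypothesis chart : local_param M phi O V.
Hypothesis u0dom : (O `&` halfspace R m) u0.
Local Notation J := ('J phi u0).
Local Notation x0 := (phi u0).
Local Notation OH := (O `&` halfspace R m).
Variables (PX : probability (borel_rV R d) R)
  (omega : {measure set (borel_rV R d) -> \bar R})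
  (f : 'rV[R]_d -> R) (f0 Kf : R).
Hypothesis cM : compact M.
Hypothesis omegaM : is_volume m M omega.
Hypothesis intf1 : (\int[omega]_(x in M) (f x)%:E = 1)%E.
Hypothesis f00 : 0 < f0.
Hypothesis f0f : forall x, M x -> f0 <= f x.
Hypothesis lipf : forall x y, M x -> M y -> `|f x - f y| <= Kf * enorm (x - y).
Hypothesis PXE : forall A : set (borel_rV R d), measurable A -> A `<=` M ->
            PX A = (\int[omega]_(x in A) (f x)%:E)%E.

Let dens u := Num.sqrt (\det ('J phi u *m ('J phi u)^T)).

Let mM : measurable (M : set (borel_rV R d)).
Proof. exact: measurable_compact_rV. Qed.

Let mV : measurable (V : set (borel_rV R d)).
Proof. by apply: measurable_open_rV; case: chart. Qed.

Lemma PX_off_manifold : PX (~` M) = 0%E.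
Proof.
by rewrite probability_setC// PXE// intf1 subee.
Qed.

Let PXI (A : set (borel_rV R d)) : measurable A -> PX A = PX (A `&` M).
Proof.
move=> mA; rewrite -[in LHS](setIT A) -(setvU M) setIUr measureU//=; last 3 first.
- by apply: measurableI => //; exact: measurableC.
- exact: measurableI.
- by rewrite setIACA setICl setI0.
rewrite [X in (X + _)%E](_ : _ = 0%E) ?add0e//.
apply/eqP; rewrite eq_le measure_ge0 andbT -PX_off_manifold.
apply: le_measure; [rewrite inE|rewrite inE|exact: subIsetr].
- by apply: measurableI => //; exact: measurableC.
- exact: measurableC.
Qed.

(** In the chart, the ball contains the corner box [u0 + [0, s]^m] with [s]
    proportional to [rho]; the corner points into the half-space, so that the box
    stays in the domain even when [u0] is on its boundary. *)
Lemma mass_lower : exists2 a : R, 0 < a & exists2 rho1 : R, 0 < rho1 &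
  forall rho, 0 < rho <= rho1 ->
   ((a * rho ^+ m)%:E <= PX [set x | (enorm (x - x0) < rho)%R])%E.
Proof.
have [g0 [g1 [g00 g10 ng]]] := volume_density_bounds chart u0dom.
have dphi0 : differentiable phi u0.
  by case: chart => _ _ [/= h _] _ _; apply: h; case: u0dom.
have nA := differentiable_jacobian_approx dphi0 (ltr01 : 0 < 1 :> R).
have nO : \forall u \near u0, O u.
  by apply: open_nbhs_nbhs; split; [case: chart|case: u0dom].
have /nbhs_ballP[r /= r0 hr] : \forall u \near u0, [/\ g0 <= dens u, O u &
    enorm (phi u - x0 - (u - u0) *m J) <= 1 * `|u - u0|].
  by apply: filterS3 ng nO nA => u /andP[? _] ? ?; split.
pose C' := \sum_i enorm (row i J) + 2.
have sJ0 : 0 <= \sum_i enorm (row i J) by apply: sumr_ge0 => i _; exact: enorm_ge0.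
have C'0 : 0 < C' by rewrite ltr_wpDl.
exists (f0 * g0 / C' ^+ m); first by rewrite divr_gt0 ?mulr_gt0// exprn_gt0.
exists (C' * r / 2) => [|rho /andP[rho0 rho1]]; first by rewrite divr_gt0 ?mulr_gt0.
pose s := rho / C'.
have s0 : 0 < s by rewrite divr_gt0.
have sr : s < r.
  rewrite ltr_pdivrMr// [r * _]mulrC; apply: (le_lt_trans rho1).
  by rewrite ltr_pdivrMr// ltr_pMr ?mulr_gt0// ltr1n.
set A : set (borel_rV R d) := [set x | _].
have mA : measurable A by apply: measurable_open_rV; exact: open_eball.
pose bx := box u0 (u0 + const_mx s).
have bxs u : bx u -> `|u - u0| <= s.
  move=> hu; apply: norm_leP => [|i]; first exact: ltW.
  have := hu i; rewrite /= in_itv/= !mxE => /andP[h1 h2].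
  by rewrite ger0_norm ?subr_ge0//; lra.
have bxr u : bx u -> ball u0 r u.
  move=> /bxs hu; rewrite -ball_normE /= -normrN opprB; exact: le_lt_trans hu sr.
have bxOH : bx `<=` OH `&` phi @^-1` A.
  move=> u bu; have [_ Ou hphi] := hr u (bxr u bu); split.
    split=> //= j j0; have := bu j; rewrite /= in_itv/= => /andP[+ _].
    by apply: le_trans; exact: u0dom.2.
  rewrite /A /=; have us := bxs u bu.
  rewrite mul1r in hphi.
  apply: (@le_lt_trans _ _ (enorm ((u - u0) *m J) + `|u - u0|)).
    rewrite -[phi u - x0](subrK ((u - u0) *m J)) addrC.
    apply: (le_trans (enormD _ _)); by rewrite lerD2l.
  apply: (@le_lt_trans _ _ ((\sum_i enorm (row i J) + 1) * s)).
    rewrite mulrDl mul1r lerD// (le_trans (enorm_mulmx_le _ _))// ler_wpM2l//.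
  rewrite /s mulrA ltr_pdivrMr// mulrC ltr_pM2l// /C'; lra.
have bxg u : bx u -> g0 <= dens u.
  by move=> bu; have [] := hr u (bxr u bu).
rewrite PXI// PXE; [|exact: measurableI|by move=> ? []].
apply: (@le_trans _ _ (\int[omega]_(x in A `&` (M `&` V)) (cst f0%:E x))%E); last first.
  apply: ge0_le_integral_sub.
  - by move=> x [? []].
  - by move=> x _; rewrite lee_fin ltW.
  - by move=> x [_ /f0f Mx]; rewrite lee_fin (le_trans _ Mx)// ltW.
  - by move=> x [_ [/f0f Mx _]]; rewrite lee_fin.
rewrite integral_cst; last by apply: measurableI => //; exact: measurableI.
rewrite (omegaM.2 _ _ _ chart)//.
apply: (@le_trans _ _ (f0%:E * \int[lebesgue_rV m]_(u in bx) (cst g0%:E u))%E); last first.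
  rewrite lee_wpmul2l ?lee_fin ?(ltW f00)//.
  apply: ge0_le_integral_sub.
  - exact: bxOH.
  - by move=> u _; rewrite lee_fin ltW.
  - by move=> u _; rewrite lee_fin sqrtr_ge0.
  - by move=> u bu; rewrite lee_fin; exact: bxg.
rewrite integral_box_cst => [|i]; last by rewrite !mxE lerDl ltW.
rewrite -!EFinM lee_fin.
under eq_bigr do rewrite !mxE addrAC subrr add0r.
by rewrite prodr_const card_ord /s expr_div_n mulrA -mulrA [_^-1 * _]mulrC !mulrA.
Qed.

(** Near [x0] both the probability density and the volume density are bounded, so
    the mass of a set is at most a constant times the volume of any box containing
    its parameters. *)
Lemma mass_upper : exists2 a : R, 0 < a & exists2 delta : R, 0 < delta &
  forall (A : set (borel_rV R d)) (p q : 'rV[R]_m), measurable A ->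
    (forall x, A x -> enorm ((x : 'rV[R]_d) - x0) < delta) ->
    (forall i, p 0 i <= q 0 i) ->
    (forall u, OH u -> A (phi u) -> box p q u) ->
   (PX A <= (a * \prod_i (q 0 i - p 0 i))%:E)%E.
Proof.
have [g0 [g1 [g00 g10 ng]]] := volume_density_bounds chart u0dom.
have [del del0 [h1 h2]] := chart_near chart u0dom ng.
pose f1 := `|f x0| + `|Kf| + 1.
have f10 : 0 < f1 by rewrite ltr_wpDl// addr_ge0.
have Mx0 : M x0.
  case: chart => _ _ _ _ [h _].
  have : (phi @` (O `&` halfspace R m)) x0 by exists u0.
  by rewrite h => -[].
exists (f1 * g1); first exact: mulr_gt0.
exists (Num.min del 1); first by rewrite lt_min del0 ltr01.
move=> A p q mA Adel pq Abox.
have AMV : A `&` M = A `&` (M `&` V).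
  apply/seteqP; split=> x [Ax]; last by case.
  move=> Mx; split=> //; split=> //; case: (h1 x Mx) => //.
  by apply: (lt_le_trans (Adel _ Ax)); rewrite ge_min lexx.
rewrite PXI// PXE; [|exact: measurableI|by move=> ? []].
apply: (@le_trans _ _ (\int[omega]_(x in A `&` (M `&` V)) (cst f1%:E x))%E).
  apply: ge0_le_integral_sub.
  - by rewrite AMV.
  - by move=> x [_ /f0f Mx]; rewrite lee_fin (le_trans _ Mx)// ltW.
  - by move=> x _; rewrite lee_fin ltW.
  - move=> x [Ax Mx]; rewrite lee_fin /f1.
    have := lipf Mx Mx0; have := Adel _ Ax; rewrite lt_min => /andP[_ x1] lx.
    have : Kf * enorm (x - x0) <= `|Kf|.
      apply: (@le_trans _ _ (`|Kf| * enorm (x - x0))).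
        by rewrite ler_wpM2r ?enorm_ge0// ler_norm.
      by rewrite ler_piMr// ltW.
    have := ler_norm (f x - f x0); have := ler_norm (f x0); lra.
rewrite integral_cst; last by apply: measurableI => //; exact: measurableI.
rewrite (omegaM.2 _ _ _ chart)//.
apply: (@le_trans _ _ (f1%:E * \int[lebesgue_rV m]_(u in box p q) (cst g1%:E u))%E).
  rewrite lee_wpmul2l ?lee_fin ?(ltW f10)//.
  apply: ge0_le_integral_sub.
  - by move=> u [uOH] /=; exact: Abox.
  - by move=> u _; rewrite lee_fin sqrtr_ge0.
  - by move=> u _; rewrite lee_fin ltW.
  - move=> u [uOH /= /Adel]; rewrite lt_min => /andP[ud _].
    by rewrite lee_fin; have /andP[] := h2 u uOH ud.
by rewrite integral_box_cst// -!EFinM lee_fin mulrA.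
Qed.
End mass.

Section boundary.
Context {R : realType} (d m : nat).

Definition eball (x0 : 'rV[R]_d) (r : R) : set 'rV[R]_d := [set x | enorm (x - x0) < r].

Definition slab (x0 nu : 'rV[R]_d) (r h : R) : set 'rV[R]_d :=
  eball x0 r `&` [set x | dotv nu (x - x0) < h].

Lemma measurable_eball x0 r : measurable (eball x0 r : set (borel_rV R d)).
Proof. by apply: measurable_open_rV; exact: open_eball. Qed.

Lemma measurable_slab x0 nu r h : measurable (slab x0 nu r h : set (borel_rV R d)).
Proof.
by apply: measurable_open_rV; apply: openI; [exact: open_eball|exact: open_halfplane].
Qed.

Lemma condition_P_off_manifold (PX : probability (borel_rV R d) R) M :
  condition_P m PX M -> measurable (~` M : set (borel_rV R d)) /\ PX (~` M) = 0%E.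
Proof.
move=> [cM _ _ _ [omega [f [f0 [Kf [_ intf1 _ _ PXE]]]]]].
split; first by apply: measurableC; exact: measurable_compact_rV.
exact: PX_off_manifold cM intf1 PXE.
Qed.

(** The vector [nu] is dual to the first parameter: [<nu, h J> = h_0]. Up to the error
    of the first-order expansion, [<nu, x - x0>] is therefore the first parameter of
    [x], since that of [x0] vanishes; it is nonnegative on the half-space, and a slab
    of height [c rho] has its parameters in a box with one side of length [O(c rho)]
    and [m - 1] sides of length [O(rho)]. The constants [a] and [L] do
    not depend on [eps]; this allows [c] to be fixed first, then [eps] small with
    respect to [c]. *)
Lemma boundary_geometry (PX : probability (borel_rV R d) R) (M : set 'rV[R]_d) x0 :
  condition_P m PX M -> mboundary m M x0 ->
  exists (nu : 'rV[R]_d) (J : 'M[R]_(m, d)) (a L : R), [/\ 0 < a, 0 < L &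
  forall eps : R, 0 < eps -> exists2 rho0 : R, 0 < rho0 &
  forall rho, 0 < rho <= rho0 ->
  [/\ forall x, M x -> eball x0 (3 * rho) x ->
        - (eps * rho) <= dotv nu (x - x0) /\
        exists h : 'rV[R]_m, enorm (x - x0 - h *m J) <= eps * rho,
      ((a * rho ^+ m)%:E <= PX (eball x0 rho))%E &
      forall c, eps <= c ->
        (PX (slab x0 nu (3 * rho) (c * rho)) <= (L * c * rho ^+ m)%:E)%E]].
Proof.
move=> [cM _ _ _ [omega [f [f0 [Kf [omegaM intf1 [f00 f0f] lipf PXE]]]]]].
case=> phi [ O [ V [u0 [chart u0dom phiu0 [j0 j00 u0j0]]]]].
have m0 : (0 < m)%N := leq_ltn_trans (leq0n j0) (ltn_ord j0).
have [K JK] := row_freeP (jacobian_row_free chart u0dom).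
pose nu := (col j0 K)^T.
have nuJ h : dotv nu (h *m 'J phi u0) = h 0 j0.
  by rewrite dotvC dotvE trmxK colE mulmxA -(mulmxA h) JK mulmx1 -colE mxE.
have [C C0 happrox] := chart_approx chart u0dom.
have [a a0 [rho1 rho10 hlow]] := mass_lower chart u0dom cM omegaM intf1 f00 f0f PXE.
have [a' a'0 [del' del'0 hup]] := mass_upper chart u0dom cM omegaM intf1 f00 f0f lipf PXE.
exists nu, ('J phi u0), a, (a' * (2 * (6 * C) ^+ m.-1)).
split=> //; first by rewrite !mulr_gt0// exprn_gt0// mulr_gt0.
move=> eps eps0.
pose e := eps / (3 * (1 + enorm nu)).
have nu1 : 0 < 1 + enorm nu by rewrite ltr_pwDl// enorm_ge0.
have e0 : 0 < e by rewrite divr_gt0// mulr_gt0.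
have [del del0 [h1 h2]] := happrox e (fun=> True) e0 (filterE _ (fun=> I)).
rewrite phiu0 in hlow hup h1 h2.
exists (Num.min rho1 (Num.min (del / 3) (del' / 3))).
  by rewrite !lt_min rho10 !divr_gt0.
move=> rho /andP[rho0]; rewrite !le_min !ler_pdivlMr// => /and3P[rl1 rl2 rl3].
have ee : e * (3 * rho) <= eps * rho.
  have -> : e * (3 * rho) = eps * rho * (1 + enorm nu)^-1.
    by rewrite /e; field; rewrite gt_eqF.
  rewrite ler_piMr ?mulr_ge0 ?(ltW eps0) ?(ltW rho0)// invf_le1//.
  by rewrite lerDl enorm_ge0.
have enu : enorm nu * (e * (3 * rho)) <= eps * rho.
  have -> : enorm nu * (e * (3 * rho)) = eps * rho * (enorm nu / (1 + enorm nu)).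
    by rewrite /e; field; rewrite gt_eqF.
  by rewrite ler_piMr ?mulr_ge0 ?(ltW eps0) ?(ltW rho0)// ler_pdivrMr// mul1r lerDr.
have key u : (O `&` halfspace R m) u -> enorm (phi u - x0) < 3 * rho ->
   [/\ `|u - u0| <= C * (3 * rho), enorm (phi u - x0 - (u - u0) *m 'J phi u0) <= eps * rho,
     0 <= u 0 j0 & `|dotv nu (phi u - x0) - u 0 j0| <= eps * rho].
  move=> uOH ur; have [|_ uC ue] := h2 u uOH.
    by apply: (lt_le_trans ur); rewrite mulrC.
  have ue' : enorm (phi u - x0 - (u - u0) *m 'J phi u0) <= e * (3 * rho).
    by apply: (le_trans ue); rewrite ler_wpM2l ?(ltW e0)// ltW.
  split.
  - by apply: (le_trans uC); rewrite ler_wpM2l ?(ltW C0)// ltW.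
  - exact: le_trans ue' ee.
  - by apply: uOH.2.
  - have -> : dotv nu (phi u - x0) - u 0 j0 = dotv nu (phi u - x0 - (u - u0) *m 'J phi u0).
      by rewrite [in RHS]dotvBr nuJ !mxE u0j0 subr0.
    apply: (le_trans (dotv_le _ _)); apply: le_trans enu.
    by rewrite ler_wpM2l ?enorm_ge0.
split.
- move=> x Mx xr.
  have [|_ [u uOH ux]] := h1 x Mx; first by apply: (lt_le_trans xr); rewrite mulrC.
  rewrite -ux in xr *; have [_ ue u_ge0] := key u uOH xr.
  rewrite ler_norml => /andP[h _]; split; first by lra.
  by exists (u - u0).
- by apply: hlow; rewrite rho0 rl1.
- move=> c epsc.
  have c0 : 0 < c by exact: lt_le_trans epsc.
  (* the factor 2 absorbs the error [eps * rho], at most [c * rho] *)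
  pose p : 'rV[R]_m := \row_i (if i == j0 then 0 else u0 0 i - C * (3 * rho)).
  pose q : 'rV[R]_m := \row_i (if i == j0 then 2 * c * rho else u0 0 i + C * (3 * rho)).
  have C3 : 0 <= C * (3 * rho) by rewrite !mulr_ge0// ltW.
  have pq i : p 0 i <= q 0 i.
    rewrite !mxE; case: ifPn => _; first by rewrite !mulr_ge0// ltW.
    lra.
  have := hup (slab x0 nu (3 * rho) (c * rho)) p q (measurable_slab _ _ _ _) _ pq _.
  have -> : \prod_i (q 0 i - p 0 i) = 2 * c * rho * (6 * C * rho) ^+ m.-1.
    rewrite (bigD1 j0)//= !mxE eqxx subr0; congr (_ * _).
    rewrite (eq_bigr (fun=> 6 * C * rho)) => [|i ij0]; last first.
      by rewrite !mxE (negbTE ij0); ring.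
    by rewrite prodr_const cardC1 card_ord.
  have -> : a' * (2 * c * rho * (6 * C * rho) ^+ m.-1) =
     a' * (2 * (6 * C) ^+ m.-1) * c * rho ^+ m.
    by rewrite exprMn -[in rho ^+ m](prednK m0) exprS; ring.
  apply.
  + move=> x [xr _]; by apply: (lt_le_trans xr); rewrite mulrC.
  + move=> u uOH [ur unu] i; have [uC _ u_ge0] := key u uOH ur.
    rewrite ler_norml => /andP[hu _].
    rewrite /= in_itv/= !mxE; case: ifPn => [/eqP->|ij0].
      rewrite u_ge0/=.
      have : eps * rho <= c * rho by rewrite ler_wpM2r// ltW.
      by move: unu => /=; lra.
    have := le_trans (norm_coord_le (u - u0) i) uC.
    rewrite !mxE ler_norml => /andP[? ?]; apply/andP; split; lra.
Qed.
End boundary.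

(** * Nearest neighbors *)

Section neighbors.
Context {R : realType} (d n : nat).
Variables (x : 'I_n -> 'rV[R]_d) (i : 'I_n) (s : seq 'I_n).
Hypothesis hs : is_neighbor_order x i s.
Let dist j := enorm (x j - x i).

Let perm_s : perm_eq s [seq j <- enum 'I_n | j != i].
Proof. by case/andP: hs. Qed.

Lemma neighbor_order_uniq : uniq s.
Proof. by rewrite (perm_uniq perm_s) filter_uniq// enum_uniq. Qed.

Lemma mem_neighbor_order j : (j \in s) = (j != i).
Proof. by rewrite (perm_mem perm_s) mem_filter mem_enum andbT. Qed.

Lemma neighbor_order_le (a b : nat) : (a <= b < size s)%N ->
  dist (nth i s a) <= dist (nth i s b).
Proof.
move=> /andP[ab bs].
have srt : sorted (fun a b => dist a <= dist b) s by case/andP: hs.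
have tr : transitive (fun a b : 'I_n => dist a <= dist b).
  by move=> u v w; exact: le_trans.
have rf : reflexive (fun a b : 'I_n => dist a <= dist b) by move=> ?; exact: lexx.
by apply: (sorted_leq_nth tr rf i srt) => //; rewrite inE// (leq_ltn_trans ab).
Qed.

(** The set [A] may contain [i] itself, which is not its own neighbor: hence the
    strict inequality between [k] and the cardinal of [A]. *)
Lemma neighbors_close (k : nat) (r : R) (A : {set 'I_n}) : (0 < k)%N ->
  (k < #|A|)%N -> (forall j, j \in A -> dist j < r) ->
  (k <= size s)%N /\ dist (nth i s k.-1) < r.
Proof.
move=> k0 kA Ar.
have szs : size s = n.-1.
  rewrite (perm_size perm_s) size_filter.
  have := count_predC (fun j => j == i) (enum 'I_n).
  rewrite size_enum_ord -/(count_mem i _) (count_uniq_mem _ (enum_uniq _)) mem_enum /=.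
  by move=> h; rewrite -[X in _ = X.-1]h.
have kn : (k < n)%N by rewrite (leq_trans kA)// -[leqRHS]card_ord max_card.
split; first by rewrite szs -ltnS prednK// (leq_ltn_trans _ kn).
rewrite ltNge; apply/negP => rk.
have sub : A \subset (i |: [set j in take k.-1 s])%SET.
  apply/fintype.subsetP => j jA; rewrite !inE; case: (eqVneq j i) => //= ji.
  have js : j \in s by rewrite mem_neighbor_order.
  rewrite in_take//; rewrite ltnNge; apply/negP => kj.
  have := Ar _ jA; rewrite ltNge => /negP; apply; apply: (le_trans rk).
  rewrite -[in leRHS](nth_index i js); apply: neighbor_order_le.
  by rewrite kj index_mem.
have := subset_leq_card sub; rewrite leqNgt => /negP; apply.
apply: leq_ltn_trans kA; rewrite cardsU1.
apply: (@leq_trans (1 + k.-1)); last by rewrite add1n prednK.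
apply: leq_add; first by case: (_ \notin _).
rewrite cardsE (leq_trans (card_size _))// size_take_min geq_minl//.
Qed.

Lemma neighbors_card (k : nat) (A : {set 'I_n}) : (k <= size s)%N ->
  (#|[set l : 'I_k | nth i s l \in A]%SET| <= #|A|)%N.
Proof.
move=> ks; rewrite -(card_in_imset (f := fun l : 'I_k => nth i s l)).
  apply: subset_leq_card; apply/fintype.subsetP => _ /imsetP[l + ->].
  by rewrite inE.
move=> a b _ _ /eqP; rewrite nth_uniq ?neighbor_order_uniq ?(leq_trans (ltn_ord _) ks)//.
by move=> /eqP ab; exact: val_inj.
Qed.

End neighbors.

(** * Lower bound on the statistic at a point near the boundary *)

Section statistic_lower_bound.
Context {R : realType} (d m n : nat).
Variables (x : 'I_n -> 'rV[R]_d) (i : 'I_n) (s : seq 'I_n) (B : 'M[R]_(m, d)) (k : nat).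
Variables (x0 nu : 'rV[R]_d) (J : 'M[R]_(m, d)) (c eps beta rho : R).
Hypotheses (k0 : (0 < k)%N) (md : (m <= d)%N).
Hypothesis hs : is_neighbor_order x i s.
Hypothesis hB : leading_eigenbasis (local_cov x i s k) B.
Hypotheses (c0 : 0 < c) (eps01 : 0 < eps <= 1) (rho0 : 0 < rho).
Hypotheses (beta0 : 0 < beta) (beta_drift : beta * (1 + enorm nu) <= c / 2).
Hypothesis eps_tilt : eps * (4^-1 + enorm nu) <= c / 4.
Hypothesis eps_flat : 8 * d%:R * eps ^+ 2 <= beta ^+ 2.
Hypothesis flat : forall j, eball x0 (3 * rho) (x j) ->
   - (eps * rho) <= dotv nu (x j - x0) /\
    exists h : 'rV[R]_m, enorm (x j - x0 - h *m J) <= eps * rho.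
Hypothesis centered : eball x0 (eps * rho) (x i).
Hypothesis crowded : (k < #|[set j | x j \in eball x0 rho]%SET|)%N.
Hypothesis thin : (4 * #|[set j | x j \in slab x0 nu (3 * rho) (c * rho)]%SET| <= k)%N.

(** The inner conormal [nu] sees a drift of the mean of order [c rho], far above the
    error [eps rho] of the flat approximation, so the mean survives the projection
    on the estimated tangent space; and the radius of the neighborhood is at most
    [2 rho]. *)
Lemma delta_stat_lower : k%:R * (beta ^+ 2 / 8) <= delta_stat x i s B k.
Proof.
have /andP[eps0 eps1] := eps01.
have kR : 0 < k%:R :> R by rewrite ltr0n.
have er : eps * rho <= rho by rewrite ler_piMl// ltW.
have xi : enorm (x i - x0) < eps * rho by exact: centered.
have [ks rk] : (k <= size s)%N /\ enorm (x (nth i s k.-1) - x i) < 2 * rho.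
  apply: (neighbors_close hs k0 crowded) => j; rewrite inE => /set_mem xj.
  have -> : x j - x i = (x j - x0) - (x i - x0) by rewrite opprB addrA subrK.
  apply: (le_lt_trans (enormB _ _)); have : enorm (x j - x0) < rho := xj.
  by lra.
pose r := knn_radius x i s k.
have rE : r = enorm (x (nth i s k.-1) - x i) by rewrite /r /knn_radius enorm_distC.
pose v (l : 'I_k) := x (nth i s l) - x i.
have vr l : enorm (v l) <= r.
  rewrite rE; apply: (neighbor_order_le hs).
  by rewrite prednK// ks andbT -ltnS prednK// ltn_ord.
have near3 (l : 'I_k) : eball x0 (3 * rho) (x (nth i s l)).
  move: (vr l) => vrl; rewrite /eball /=.
  have -> : x (nth i s l) - x0 = v l + (x i - x0) by rewrite /v addrA subrK.
  apply: (le_lt_trans (enormD _ _)); move: rk; rewrite -rE; lra.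
pose ybar := k%:R^-1 *: \sum_j row j (knn_matrix x i s k).
have rowE l : row l (knn_matrix x i s k) = v l by apply/rowP => j; rewrite !mxE.
have ybarE : ybar = k%:R^-1 *: \sum_l v l.
  by congr (_ *: _); apply: eq_bigr => l _; rewrite rowE.
(* A neighbor outside the slab contributes [c * rho], one in the slab at least
   [- eps * rho], and at most a quarter of the neighbors are in the slab. *)
have drift : c / 2 * rho <= dotv nu ybar.
  rewrite ybarE dotvZr dotv_sumr ler_pdivlMl//.
  pose S := [set l : 'I_k | nth i s l \in [set j | x j \in slab x0 nu (3 * rho) (c * rho)]%SET]%SET.
  have cS : 4 * #|S|%:R <= k%:R :> R.
    rewrite -natrM ler_nat; apply: leq_trans thin; rewrite leq_mul2l/=.
    exact: (neighbors_card hs _ ks).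
  have nui : dotv nu (x i - x0) <= enorm nu * (eps * rho).
    apply: (le_trans (ler_norm _)); apply: (le_trans (dotv_le _ _)).
    by rewrite ler_wpM2l ?enorm_ge0// ltW.
  pose bnd l := (if l \in S then - (eps * rho) else c * rho) - enorm nu * (eps * rho).
  apply: (@le_trans _ _ (\sum_l bnd l)); last first.
    apply: ler_sum => l _.
    have -> : v l = (x (nth i s l) - x0) - (x i - x0) by rewrite opprB addrA subrK.
    rewrite dotvBr /bnd; apply: lerB => //; case: ifPn => [_|].
      by have [] := flat (near3 l).
    rewrite !inE => xl; rewrite leNgt; apply/negP => h; move/negP: xl; apply.
    by apply/mem_set; split=> //; exact: near3.
  have -> : \sum_l bnd l = k%:R * (c * rho - enorm nu * (eps * rho)) - #|S|%:R * (c * rho + eps * rho).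
    rewrite /bnd (eq_bigr (fun l => (c * rho - enorm nu * (eps * rho)) -
       (if l \in S then c * rho + eps * rho else 0))); last first.
      by move=> l _; case: ifPn => _; ring.
    rewrite sumrB sumr_const card_ord mulr_natl; congr (_ - _).
    by rewrite -big_mkcond/= sumr_const mulr_natl.
  have cr : 0 <= c * rho + eps * rho by rewrite addr_ge0// mulr_ge0// ltW.
  have h1 : 4 * #|S|%:R * (c * rho + eps * rho) <= k%:R * (c * rho + eps * rho).
    by rewrite ler_wpM2r.
  have h2 : k%:R * (eps * (4^-1 + enorm nu)) * rho <= k%:R * (c / 4) * rho.
    by rewrite ler_wpM2r ?(ltW rho0)// ler_wpM2l// ltW.
  lra.
have nu1 : 0 < 1 + enorm nu by rewrite ltr_pwDl// enorm_ge0.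
have ybar_ge : beta * rho <= enorm ybar.
  have := le_trans (le_trans drift (ler_norm _)) (dotv_le _ _) => h.
  have h' : c / 2 * rho <= (1 + enorm nu) * enorm ybar.
    by apply: (le_trans h); rewrite ler_wpM2r ?enorm_ge0// lerDr.
  rewrite -(ler_pM2l nu1); apply: le_trans h'.
  by rewrite mulrA (mulrC _ beta) ler_wpM2r// ltW.
have ybar_le : enorm ybar <= r.
  rewrite ybarE enormZ gtr0_norm ?invr_gt0// ler_pdivrMl//.
  apply: (le_trans (enorm_sum _ _)).
  rewrite mulr_natl -[X in _ *+ X]card_ord -sumr_const.
  by apply: ler_sum => l _.
(* a positive radius is needed, since division by 0 would make the statistic 0 *)
have r0 : 0 < r by apply: lt_le_trans ybar_le; apply: lt_le_trans ybar_ge; exact: mulr_gt0.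
have r2 : r <= 2 * rho by rewrite rE ltW.
have yflat (l : 'I_k) : exists h : 'rV[R]_m,
    enorm (row l (knn_matrix x i s k) - h *m J) <= 2 * (eps * rho).
  have [_ [h hh]] := flat (near3 l).
  have [|_ [g gg]] := flat (j := i).
    by rewrite /eball/=; apply: (lt_le_trans xi); lra.
  exists (h - g); rewrite rowE mulmxBl.
  have -> : v l - (h *m J - g *m J) =
      (x (nth i s l) - x0 - h *m J) - (x i - x0 - g *m J).
    rewrite /v !opprB !addrA; apply/rowP => j; rewrite !mxE; ring.
  by apply: (le_trans (enormB _ _)); lra.
have := pca_mean k0 md yflat hB.
rewrite -/ybar => hp.
have projE : knn_proj_mean x i s B k = proj_rows B ybar.
  rewrite /knn_proj_mean ybarE /proj_rows -!scalemxAl !mulmx_suml.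
  by congr (_ *: _); apply: eq_bigr.
have hq : beta ^+ 2 / 2 * rho ^+ 2 <= enorm (proj_rows B ybar) ^+ 2.
  apply: le_trans hp.
  have h1 : (beta * rho) ^+ 2 <= enorm ybar ^+ 2.
    by rewrite ler_sqr ?nnegrE ?enorm_ge0// mulr_ge0// ltW.
  have h2 : 8 * d%:R * eps ^+ 2 * rho ^+ 2 <= beta ^+ 2 * rho ^+ 2.
    by rewrite ler_wpM2r// sqr_ge0.
  have e1 : (beta * rho) ^+ 2 = beta ^+ 2 * rho ^+ 2 by rewrite exprMn.
  have e2 : d%:R * (2 * (eps * rho)) ^+ 2 = 2^-1 * (8 * d%:R * eps ^+ 2 * rho ^+ 2) by field.
  by rewrite e2; rewrite e1 in h1; lra.
rewrite /delta_stat projE -/r.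
have rr : r ^+ 2 <= 4 * rho ^+ 2.
  have -> : 4 * rho ^+ 2 = (2 * rho) ^+ 2 by ring.
  by rewrite ler_sqr ?nnegrE// ?(ltW r0)// mulr_ge0// ltW.
apply: (@le_trans _ _ (k%:R / r ^+ 2 * enorm (proj_rows B ybar) ^+ 2)); last first.
  rewrite -!mulrA ler_peMl//; last by rewrite ler1n addn2.
  by apply: mulr_ge0 => //; apply: mulr_ge0; rewrite ?invr_ge0 sqr_ge0.
rewrite -mulrA ler_wpM2l ?(ltW kR)// ler_pdivlMl ?exprn_gt0//.
apply: le_trans hq.
have : r ^+ 2 * (beta ^+ 2 / 8) <= 4 * rho ^+ 2 * (beta ^+ 2 / 8).
  by rewrite ler_wpM2r// divr_ge0// sqr_ge0.
lra.
Qed.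
End statistic_lower_bound.

(** * Growth of the number of neighbors *)

Section growth.
Context {R : realType} (m : nat) (k : nat -> nat).
Hypothesis m0 : (0 < m)%N.
Hypothesis hk : condition_K R m k.

Let ln_ge1 : \forall n \near \oo, 1 <= ln n%:R :> R.
Proof.
near=> n; have h : expR 1 <= n%:R :> R by near: n; exact: nbhs_infty_ger.
by rewrite -ler_expR lnK ?posrE ?(lt_le_trans _ h) ?expR_gt0.
Unshelve. all: by end_near. Qed.

Lemma condition_K_ln (C : R) : \forall n \near \oo, C * ln n%:R <= (k n)%:R :> R.
Proof.
case: hk => _ _ k1 k2.
have [m1|m1] := ltnP 1 m.
  have /cvgryPge/(_ `|C|) := k1 m1.
  apply: filterS2 ln_ge1 => n n1.
  have l0 : 0 < ln n%:R :> R by exact: lt_le_trans n1.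
  rewrite ler_pdivlMr ?exprn_gt0// => h; apply: le_trans h.
  apply: (le_trans (ler_wpM2r (ltW l0) (ler_norm C))).
  by rewrite ler_wpM2l// -[leLHS]expr1 ler_weXn2l.
have m1' : m = 1%N by apply/eqP; rewrite eqn_leq m1.
have /cvgryPge/(_ `|C|) := k2 m1'.
apply: filterS2 ln_ge1 => n n1.
have l0 : 0 < ln n%:R :> R by exact: lt_le_trans n1.
have n0 : 0 < n%:R :> R by rewrite ltNge; apply/negP => /ln0 h; move: l0; rewrite h ltxx.
rewrite ler_pdivlMr ?sqrtr_gt0 ?mulr_gt0// => h; apply: le_trans h.
apply: (le_trans (ler_wpM2r (ltW l0) (ler_norm C))).
rewrite ler_wpM2l// -[leLHS](gtr0_norm l0) -sqrtr_sqr ler_wsqrtr//.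
rewrite expr2 ler_wpM2r ?(ltW l0)// -ler_expR lnK ?posrE//.
by apply: le_trans (expR_ge1Dx _); rewrite lerDr.
Qed.

Lemma condition_K_small (e : R) : 0 < e ->
  \forall n \near \oo, (k n)%:R <= e * n%:R :> R.
Proof.
move=> e0; case: hk => _ + _ _ => /cvgr0Pnorm_lt/(_ _ e0).
apply: filterS2 (nbhs_infty_ge 1) => n n1.
have n1R : 1 <= n%:R :> R by rewrite ler1n.
have p0 : 0 < n%:R `^ (m.+1%:R)^-1 :> R by rewrite powR_gt0// (lt_le_trans ltr01).
rewrite ger0_norm ?divr_ge0 ?(ltW p0)// ltr_pdivrMr// => /ltW h; apply: (le_trans h).
rewrite ler_wpM2l ?(ltW e0)// -[leRHS]powRr1 ?(le_trans ler01)//.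
by rewrite ler_powR// invf_le1// ler1n.
Qed.
End growth.

(** * Almost sure properties of the sample *)

Section borel_cantelli.
Context {R : realType}.

(** Telescoping comparison with [2 - 1 / n]. *)
Lemma sum_inv_sqr_le2 n : \sum_(i < n) (i.+1%:R ^- 2) <= 2 :> R.
Proof.
suff h N : \sum_(i < N.+1) (i.+1%:R ^- 2) <= 2 - N.+1%:R^-1 :> R.
  case: n => [|n]; first by rewrite big_ord0.
  by apply: (le_trans (h n)); rewrite gerBl invr_ge0.
elim: N => [|N IH]; first by rewrite big_ord_recr big_ord0/= expr1n invr1; lra.
rewrite big_ord_recr/=; apply: (le_trans (lerD IH (lexx _))).
have a0 : 0 < N.+1%:R :> R by rewrite ltr0n.
have -> : N.+2%:R = N.+1%:R + 1 :> R by rewrite -natr1.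
move: (N.+1%:R : R) a0 => a a0.
have a1 : 0 < a + 1 by rewrite addr_gt0.
rewrite -addrA lerD2l.
have -> : - a^-1 + (a + 1) ^- 2 = - ((a^+2 + a + 1) / (a * (a + 1) ^+ 2)).
  by field; rewrite !gt_eqF.
rewrite lerN2 -subr_ge0.
have -> : (a ^+ 2 + a + 1) / (a * (a + 1) ^+ 2) - (a + 1)^-1 = 1 / (a * (a + 1) ^+ 2).
  by field; rewrite !gt_eqF.
by rewrite divr_ge0// mulr_ge0 ?exprn_ge0// ltW.
Qed.

Lemma borel_cantelli_inv_sqr dd (T : measurableType dd) (P : probability T R)
    (F : nat -> set T) (D : R) (N : nat) : 0 <= D ->
  (forall n, measurable (F n)) ->
  (forall n, (N <= n)%N -> (P (F n) <= (D * n%:R ^- 2)%:E)%E) ->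
  {ae P, forall w, exists n0, forall n, (n0 <= n)%N -> ~ F n w}.
Proof.
move=> D0 mF PF.
pose G n := F (N + n.+1)%N.
have PG n : (P (G n) <= (D * n.+1%:R ^- 2)%:E)%E.
  apply: (le_trans (PF _ _)); first exact: leq_addr.
  rewrite lee_fin ler_wpM2l// lef_pV2 ?posrE ?exprn_gt0 ?ltr0n ?addnS//.
  by rewrite lerXn2r ?nnegrE// ler_nat ltnS leq_addl.
have sG : (\sum_(n <oo) P (G n) < +oo)%E.
  apply: (@le_lt_trans _ _ (D * 2)%:E); last exact: ltry.
  apply: lime_le; first exact: is_cvg_nneseries.
  apply: nearW => n; rewrite big_mkord.
  apply: (@le_trans _ _ (\sum_(i < n) (D * i.+1%:R ^- 2)%:E)%E); first exact: lee_sum.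
  by rewrite sumEFin lee_fin -mulr_sumr ler_wpM2l// sum_inv_sqr_le2.
have mG n : measurable (G n) by exact: mF.
have PG0 := lim_sup_set_cvg0 mG sG.
exists (lim_sup_set G); split=> //.
  by apply: bigcap_measurable => // n _; exact: bigcup_measurable.
move=> w /= nw n _; apply: contrapT => hn; apply: nw.
exists (N + n.+1)%N => l hl Fl; apply: hn.
exists (l - N.+1)%N => /=; first by lia.
by rewrite /G (_ : (N + (l - N.+1).+1)%N = l)//; lia.
Qed.
End borel_cantelli.

Section tails.
Context (R : realType) (dT dE : measure_display) (T : measurableType dT)
  (E : measurableType dE) (P : probability T R).
Variables (X : nat -> {RV P >-> E}) (Q : probability E R).
Hypothesis iidX : iid X Q.
Variables (A : set E).
Hypothesis mA : measurable A.
Local Notation p := (fine (Q A)).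

Lemma no_hit_le n :
  (P [set w | hit_count X A n w == 0%N] <= (expR (- (n%:R * p / 2)))%:E)%E.
Proof.
apply: (le_trans (@chernoff _ _ _ _ _ _ _ _ iidX _ mA n 0 (pred1 0%N) 2^-1 _ _)).
- by [].
- by move=> c /eqP->.
- by rewrite lee_fin expr0 invr1 mul1r ler_expR; lra.
Qed.

Lemma few_hits_le n k : 8 * k%:R <= n%:R * p ->
  (P [set w | (hit_count X A n w <= k)%N] <= (expR (- k%:R))%:E)%E.
Proof.
move=> kp.
apply: (le_trans (@chernoff _ _ _ _ _ _ _ _ iidX _ mA n k (fun c => (c <= k)%N) 2^-1 _ _)).
- by [].
- by move=> c ck; rewrite ler_wiXn2l// invf_le1// ler1n.
rewrite lee_fin exprVn invrK.
have e2 : 2 ^+ k <= expR k%:R :> R.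
  rewrite -[k%:R]mulr1 expRM_natl lerXn2r ?nnegrE ?expR_ge0//.
  exact: expR_ge1Dx.
apply: (le_trans (ler_wpM2r (expR_ge0 _) e2)); rewrite -expRD ler_expR; have := ler0n R k; lra.
Qed.

(** With a weight of base [exp 8], the threshold [k / 4] contributes [exp (- 2 k)] and
    the expected number of hits at most [exp k]; the constant prefactor pays for the
    integer part of [k / 4]. *)
Lemma many_hits_le n k : expR 8 * (n%:R * p) <= k%:R ->
  (P [set w | (k < 4 * hit_count X A n w)%N] <= (expR 8 * expR (- k%:R))%:E)%E.
Proof.
move=> kp.
apply: (le_trans (@chernoff _ _ _ _ _ _ _ _ iidX _ mA n (k %/ 4)%N
   (fun c => (k < 4 * c)%N) (expR 8) _ _)).
- exact: expR_gt0.
- move=> c ck; apply: ler_weXn2l; first by rewrite -expR0 ler_expR.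
  lia.
rewrite lee_fin -expRM_natl -expRN -!expRD ler_expR.
have k4 : k%:R <= 4 * (k %/ 4)%:R + 3 :> R.
  by rewrite -natrM -natrD ler_nat; lia.
have p0 : 0 <= n%:R * p by rewrite mulr_ge0// fine_ge0.
move: (n%:R * p) (expR 8) kp p0 => y e kp y0; lra.
Qed.
End tails.

Section quantile.
Context {R : realType}.

(** The quantile is at most [4 ln (G n)], where [G] collects the constants, and
    [G n <= n ^ 2] for [n >= G]. *)
Lemma quantile_le_ln (m n : nat) (alpha : R) :
  0 < alpha < 1 -> (0 < n)%N ->
  2 `^ (m%:R / 2) * (2 * expR 1 ^+ 3) / (9 * alpha) <= n%:R ->
  chi2_sf_inv m (9 * alpha / (2 * expR 1 ^+ 3 * n%:R)) <= 8 * ln n%:R.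
Proof.
move=> /andP[a0 a1] n0; set G := _ / (9 * alpha) => Gn.
have nR : 1 <= n%:R :> R by rewrite ler1n.
have nR0 : 0 < n%:R :> R by rewrite ltr0n.
have e2 : 2 <= expR 1 :> R by have := expR_ge1Dx (1 : R); lra.
have e3 : 8 <= expR 1 ^+ 3 :> R.
  have -> : 8 = 2 ^+ 3 :> R by rewrite -natrX.
  by rewrite lerXn2r ?nnegrE ?expR_ge0.
have den0 : 0 < 2 * expR 1 ^+ 3 * n%:R :> R by rewrite !mulr_gt0// exprn_gt0// expR_gt0.
have q01 : 0 < 9 * alpha / (2 * expR 1 ^+ 3 * n%:R) < 1.
  rewrite divr_gt0 ?mulr_gt0//= ltr_pdivrMr// mul1r.
  apply: (@lt_le_trans _ _ (2 * expR 1 ^+ 3 * 1)); first lra.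
  by rewrite ler_wpM2l// mulr_ge0// exprn_ge0// expR_ge0.
apply: (le_trans (chi2_sf_inv_le m q01)).
have -> : 8 * ln n%:R = 4 * ln (n%:R * n%:R) :> R.
  by rewrite lnM ?posrE//; lra.
rewrite ler_wpM2l//.
have G0 : 0 < G by rewrite divr_gt0// ?mulr_gt0 ?powR_gt0// exprn_gt0// expR_gt0.
have -> : 2 `^ (m%:R / 2) / (9 * alpha / (2 * expR 1 ^+ 3 * n%:R)) = G * n%:R.
  by rewrite /G; field; rewrite !gt_eqF// ?exprn_gt0 ?expR_gt0.
have Gn0 : 0 < G * n%:R by exact: mulr_gt0.
have nn0 : 0 < n%:R * n%:R :> R by exact: mulr_gt0.
rewrite ler_ln ?posrE//; exact: (ler_wpM2r (ltW nR0) Gn).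
Qed.
End quantile.

Section typical_samples.
Context (R : realType) (d m : nat).
Hypothesis m0 : (0 < m)%N.
Variables (k : nat -> nat) (hk : condition_K R m k)
    (disp : measure_display) (T : measurableType disp) (P : probability T R)
    (X : nat -> {RV P >-> borel_rV R d}) (PX : probability (borel_rV R d) R)
    (hX : iid X PX).
Variables (x0 nu : 'rV[R]_d) (a L c eps rho0 : R).
Hypotheses (a0 : 0 < a) (eps01 : 0 < eps <= 1)  (rho00 : 0 < rho0).
Hypothesis cE : 8 * expR 8 * L * c <= a.
Hypothesis low : forall rho, 0 < rho <= rho0 ->
   ((a * rho ^+ m)%:E <= PX (eball x0 rho))%E.
Hypothesis thin : forall rho, 0 < rho <= rho0 ->
  (PX (slab x0 nu (3 * rho) (c * rho)) <= (L * c * rho ^+ m)%:E)%E.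

(** The scale at which the lower bound on the mass of the ball predicts [8 k_n]
    sample points. *)
Definition rho n : R := (8 * (k n)%:R / (a * n%:R)) `^ m%:R^-1.

Let k0 n : 0 < (k n)%:R :> R.
Proof. by case: hk => h _ _ _; rewrite ltr0n. Qed.

Let rho_gt0 n : (0 < n)%N -> 0 < rho n.
Proof. by move=> n0; rewrite powR_gt0// divr_gt0 ?mulr_gt0// ltr0n. Qed.

Let rhoX n : (0 < n)%N -> rho n ^+ m = 8 * (k n)%:R / (a * n%:R).
Proof.
move=> n0; rewrite /rho -powR_mulrn ?powR_ge0// -powRrM mulVf ?pnatr_eq0 -?lt0n//.
by rewrite powRr1// divr_ge0 ?mulr_ge0// ltW.
Qed.

Let rho_small : \forall n \near \oo, rho n <= rho0.
Proof.
have e0 : 0 < a * rho0 ^+ m / 8 by rewrite divr_gt0 ?mulr_gt0 ?exprn_gt0.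
have := condition_K_small hk e0.
apply: filterS2 (nbhs_infty_ge 1) => n n0 kn.
have nR0 : 0 < n%:R :> R by rewrite ltr0n.
rewrite -(@ler_pXn2r _ m) ?nnegrE ?(ltW rho00) ?(ltW (rho_gt0 n0))//.
rewrite rhoX// ler_pdivrMr ?mulr_gt0//; lra.
Qed.

(** Outside this event, the sample satisfies the counting hypotheses of
    [delta_stat_lower] at the scale [rho n]. *)
Definition atypical n : set T :=
  [set w | hit_count X (eball x0 (eps * rho n)) n w == 0%N] `|`
  [set w | (hit_count X (eball x0 (rho n)) n w <= k n)%N] `|`
  [set w | (k n < 4 * hit_count X (slab x0 nu (3 * rho n) (c * rho n)) n w)%N].

Lemma measurable_atypical n : measurable (atypical n).
Proof.
apply: measurableU; first apply: measurableU.
- exact: (@measurable_hit_count _ _ _ _ _ _ _ _ (measurable_eball _ _) n (pred1 0%N)).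
- exact: (@measurable_hit_count _ _ _ _ _ _ _ _ (measurable_eball _ _) n (fun l => l <= k n)%N).
- exact: (@measurable_hit_count _ _ _ _ _ _ _ _ (measurable_slab _ _ _ _) n (fun l => k n < 4 * l)%N).
Qed.

(** The expected numbers of points in the small ball and in the ball are at least
    [8 eps^m k_n] and [8 k_n], and at most [exp (- 8) k_n] in the slab by the choice
    of [c]; all three tail bounds are exponentially small in [k_n], which exceeds
    any multiple of [ln n]. *)
Lemma atypical_le : \forall n \near \oo, (P (atypical n) <= ((2 + expR 8) * n%:R ^- 2)%:E)%E.
Proof.
have /andP[eps0 eps1] := eps01.
pose gamma := Num.min 1 (4 * eps ^+ m).
have gamma0 : 0 < gamma by rewrite lt_min ltr01 mulr_gt0// exprn_gt0.
have := condition_K_ln m0 hk (2 / gamma).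
apply: filterS3 rho_small (nbhs_infty_ge 1) => n rn n0 kn.
have rp : 0 < rho n <= rho0 by rewrite rho_gt0.
have rp' : 0 < eps * rho n <= rho0.
  rewrite mulr_gt0 ?rho_gt0//= (le_trans _ rn)// ler_piMl// ltW// rho_gt0//.
have nR0 : 0 < n%:R :> R by rewrite ltr0n.
have gk : expR (- (gamma * (k n)%:R)) <= n%:R ^- 2.
  have -> : n%:R ^- 2 = expR (- (2 * ln n%:R)) :> R.
    by rewrite expRN expRM_natl lnK ?posrE.
  by rewrite ler_expR lerN2 -ler_pdivrMl// mulrA (mulrC gamma^-1).
have g1 : gamma <= 1 by rewrite ge_min lexx.
have g4 : gamma <= 4 * eps ^+ m by rewrite ge_min lexx orbT.
have fin A : measurable A -> PX A = (fine (PX A))%:E by move=> mA; rewrite fineK// fin_num_measure.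
have p1 : 8 * (eps ^+ m * (k n)%:R) <= n%:R * fine (PX (eball x0 (eps * rho n))).
  have := low rp'; rewrite fin ?lee_fin; last exact: measurable_eball.
  move=> /(ler_wpM2l (ltW nR0)); apply: le_trans.
  rewrite exprMn rhoX// le_eqVlt; apply/orP; left; apply/eqP.
  by field; rewrite !gt_eqF.
have p2 : 8 * (k n)%:R <= n%:R * fine (PX (eball x0 (rho n))).
  have := low rp; rewrite fin ?lee_fin; last exact: measurable_eball.
  move=> /(ler_wpM2l (ltW nR0)); apply: le_trans.
  rewrite rhoX// le_eqVlt; apply/orP; left; apply/eqP.
  by field; rewrite !gt_eqF.
have p3 : expR 8 * (n%:R * fine (PX (slab x0 nu (3 * rho n) (c * rho n)))) <= (k n)%:R.
  have := thin rp; rewrite fin ?lee_fin; last exact: measurable_slab.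
  move=> /(ler_wpM2l (ltW nR0)) /(ler_wpM2l (expR_ge0 8)) h; apply: (le_trans h).
  have -> : expR 8 * (n%:R * (L * c * rho n ^+ m)) = (8 * expR 8 * L * c) * ((k n)%:R / a).
    by rewrite rhoX//; field; rewrite !gt_eqF.
  apply: (@le_trans _ _ (a * ((k n)%:R / a))); last by rewrite mulrC divfK// gt_eqF.
  by rewrite ler_wpM2r// divr_ge0// ltW.
have ek : expR (- (k n)%:R) <= n%:R ^- 2 :> R.
  apply: le_trans gk; rewrite ler_expR lerN2 ler_piMl// ltW//.
have h1 := no_hit_le hX (measurable_eball x0 (eps * rho n)) n.
have h2 := few_hits_le hX (measurable_eball x0 (rho n)) p2.
have h3 := many_hits_le hX (measurable_slab x0 nu (3 * rho n) (c * rho n)) p3.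
have b1 : (P [set w | hit_count X (eball x0 (eps * rho n)) n w == 0%N] <= (n%:R ^- 2)%:E)%E.
  apply: (le_trans h1); rewrite lee_fin; apply: le_trans gk.
  rewrite ler_expR lerN2.
  have : gamma * (k n)%:R <= 4 * eps ^+ m * (k n)%:R by rewrite ler_wpM2r// ltW.
  lra.
have b2 : (P [set w | (hit_count X (eball x0 (rho n)) n w <= k n)%N] <= (n%:R ^- 2)%:E)%E.
  by apply: (le_trans h2); rewrite lee_fin.
have b3 : (P [set w | (k n < 4 * hit_count X (slab x0 nu (3 * rho n) (c * rho n)) n w)%N] <= (expR 8 * n%:R ^- 2)%:E)%E.
  by apply: (le_trans h3); rewrite lee_fin ler_wpM2l// expR_ge0.
have m1 := @measurable_hit_count _ _ _ _ _ _ X _ (measurable_eball x0 (eps * rho n)) n (pred1 0%N).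
have m2 := @measurable_hit_count _ _ _ _ _ _ X _ (measurable_eball x0 (rho n)) n (fun l => l <= k n)%N.
have m3 := @measurable_hit_count _ _ _ _ _ _ X _ (measurable_slab x0 nu (3 * rho n) (c * rho n)) n (fun l => k n < 4 * l)%N.
have -> : (2 + expR 8) * n%:R ^- 2 = n%:R ^- 2 + n%:R ^- 2 + expR 8 * n%:R ^- 2 :> R by ring.
rewrite !EFinD /atypical.
apply: (le_trans (measureU2 _ _ _)) => //; first exact: measurableU.
apply: leeD => //; apply: (le_trans (measureU2 _ _ _)) => //; exact: leeD.
Qed.

Lemma eventually_good : {ae P, forall w, \forall n \near \oo,
  exists r : R, [/\ 0 < r <= rho0,
    exists i : 'I_n, eball x0 (eps * r) (X i w),
    (k n < #|[set j : 'I_n | (X j w : 'rV[R]_d) \in eball x0 r]%SET|)%N &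
    (4 * #|[set j : 'I_n | (X j w : 'rV[R]_d) \in slab x0 nu (3 * r) (c * r)]%SET| <= k n)%N]}.
Proof.
have [N _ hN] := atypical_le.
have D0 : 0 <= 2 + expR 8 :> R by rewrite addr_ge0// expR_ge0.
have := borel_cantelli_inv_sqr D0 measurable_atypical hN.
apply: filterS => w [n0 hn0].
have n0oo : \forall n \near \oo, (n0 <= n)%N by exact: nbhs_infty_ge.
apply: filterS3 n0oo rho_small (nbhs_infty_ge 1) => n nn0 rn n1.
have cntE A : hit_count X A n w = #|[set j : 'I_n | (X j w : 'rV[R]_d) \in A]%SET|.
  by apply: eq_card => j; rewrite !inE ffunE.
have := hn0 n nn0; rewrite /atypical => /not_orP[/not_orP[/= b1 b2] b3].
exists (rho n); split.
- by rewrite rho_gt0.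
- move: b1; rewrite cntE => /negP; rewrite -lt0n card_gt0 => /set0Pn[i].
  by rewrite inE => /set_mem hi; exists i.
- by move: b2; rewrite cntE => /negP; rewrite -ltnNge.
- by move: b3; rewrite /= cntE => /negP; rewrite -leqNgt.
Qed.
End typical_samples.

(** * Power of the test *)

Theorem theorem2 (R : realType) (d d' : nat) (hd : (0 < d' <= d)%N)
    (k : nat -> nat) (hk : condition_K R d' k)
    (disp : measure_display) (T : measurableType disp) (P : probability T R)
    (X : nat -> {RV P >-> borel_rV R d}) (PX : probability (borel_rV R d) R)
    (hX : iid X PX)
    (M : set 'rV[R]_d) (hM : condition_P d' PX M)
    (alpha : R) (halpha : 0 < alpha < 1)
    (s : forall n, T -> 'I_n -> seq 'I_n)
    (hs : forall n w (i : 'I_n),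
        is_neighbor_order (fun j : 'I_n => X j w : 'rV[R]_d) i (s n w i))
    (B : forall n, T -> 'I_n -> 'M[R]_(d', d))
    (hB : forall n w (i : 'I_n), leading_eigenbasis
        (local_cov (fun j : 'I_n => X j w : 'rV[R]_d) i (s n w i) (k n))
        (B n w i)) :
  mboundary d' M !=set0 ->
  {ae P, forall w, exists n0 : nat, forall n : nat, (n0 <= n)%N ->
    rejects alpha (fun j : 'I_n => X j w : 'rV[R]_d) (s n w) (B n w) (k n)}.
Proof.
move=> [x0 x0bd]; have /andP[d'0 d'd] := hd.
have [nu [J [a [L [a0 L0 geom]]]]] := boundary_geometry hM x0bd.
(* [c] makes the slab carry a small fraction of the mass of the ball; [eps] then
   makes all first-order errors small compared to the drift [beta] it creates *)
pose c := a / (8 * expR 8 * L).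
have e8 : 0 < expR 8 :> R by exact: expR_gt0.
have c0 : 0 < c by rewrite divr_gt0 ?mulr_gt0.
have cE : 8 * expR 8 * L * c <= a.
  by rewrite /c mulrC divfK// gt_eqF ?mulr_gt0.
have nu0 := enorm_ge0 nu.
pose beta := c / (2 * (1 + enorm nu)).
have nu1 : 0 < 1 + enorm nu by rewrite ltr_pwDl.
have beta0 : 0 < beta by rewrite divr_gt0// mulr_gt0.
have beta_drift : beta * (1 + enorm nu) <= c / 2.
  by rewrite le_eqVlt; apply/orP; left; apply/eqP; rewrite /beta; field; rewrite gt_eqF.
have d1 : 1 <= d%:R :> R by rewrite ler1n (leq_trans d'0 d'd).
have d8 : 0 < 8 * d%:R :> R by rewrite mulr_gt0// (lt_le_trans ltr01).
have t0 : 0 < 4^-1 + enorm nu by rewrite ltr_pwDl// invr_gt0.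
pose eps := Num.min (Num.min 1 c) (Num.min (c / 4 / (4^-1 + enorm nu)) (beta / (8 * d%:R))).
have c4 : 0 < c / 4 by exact: divr_gt0.
have eps0 : 0 < eps.
  by rewrite !lt_min ltr01 c0 (divr_gt0 c4 t0) (divr_gt0 beta0 d8).
have : eps <= Num.min (Num.min 1 c) (Num.min (c / 4 / (4^-1 + enorm nu)) (beta / (8 * d%:R))).
  by rewrite /eps lexx.
move: (eps) eps0 => {}eps eps0; rewrite !le_min => /andP[/andP[eps1 epsc] /andP[epst epsf]].
have {}epst : eps * (4^-1 + enorm nu) <= c / 4 by rewrite -ler_pdivlMr.
have eps_flat : 8 * d%:R * eps ^+ 2 <= beta ^+ 2.
  rewrite ler_pdivlMr// mulrC in epsf.
  rewrite expr2 mulrA expr2; apply: ler_pM => //; rewrite ?(ltW eps0) ?mulr_ge0 ?(ltW d8) ?(ltW eps0)//.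
  apply: le_trans epsf; rewrite ler_peMl ?(ltW eps0)//; lra.
have eps01 : 0 < eps <= 1 by rewrite eps0 eps1.
have [rho0 rho00 hgeom] := geom eps eps0.
have low rho : 0 < rho <= rho0 -> ((a * rho ^+ d')%:E <= PX (eball x0 rho))%E.
  by move=> /hgeom[].
have thin rho : 0 < rho <= rho0 ->
    (PX (slab x0 nu (3 * rho) (c * rho)) <= (L * c * rho ^+ d')%:E)%E.
  by move=> /hgeom[_ _]; apply.
have good := eventually_good d'0 hk hX a0 eps01 rho00 cE low thin.
have onM : {ae P, forall w, forall j, M (X j w)}.
  apply: ae_foralln => j.
  have [mMC PMC] := condition_P_off_manifold hM.
  exists (X j @^-1` (~` M)); split=> //.
  - by rewrite -[_ @^-1` _]setTI; exact: measurable_funP.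
  - by rewrite -PMC -(hX.2 j).
have : \forall n \near \oo, (64 / beta ^+ 2) * ln n%:R <= (k n)%:R :> R.
  exact: (condition_K_ln d'0 hk).
move=> kln.
have nG : \forall n \near \oo,
    2 `^ (d'%:R / 2) * (2 * expR 1 ^+ 3) / (9 * alpha) <= n%:R :> R.
  exact: nbhs_infty_ger.
apply: filterS2 good onM => w good onM.
have [n0 _ hn0] : \forall n \near \oo,
    rejects alpha (fun j : 'I_n => X j w : 'rV[R]_d) (s n w) (B n w) (k n).
  apply: filterS3 (filterI good kln) nG (nbhs_infty_ge 1) => n [[r [rr [i hi] hcr hth]] kn] Gn n1.
  have [r0 _] := andP rr.
  have [hflat _ _] := hgeom r rr.
  have hk0 : (0 < k n)%N by case: hk.
  have := @delta_stat_lower R d d' n (fun j : 'I_n => X j w : 'rV[R]_d) i (s n w i) (B n w i) (k n)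
    x0 nu J c eps beta r hk0 d'd (hs n w i) (hB n w i) c0 eps01 r0 beta0 beta_drift epst eps_flat
    (fun j => hflat _ (onM j)) hi hcr hth.
  move=> hdelta.
  rewrite /rejects; apply: (le_trans (quantile_le_ln halpha n1 Gn)).
  apply: (@le_trans _ _ ((k n)%:R * (beta ^+ 2 / 8))).
    have b8 : 0 < beta ^+ 2 / 8 by rewrite divr_gt0// exprn_gt0.
    rewrite -ler_pdivrMr//; apply: le_trans kn.
    rewrite le_eqVlt; apply/orP; left; apply/eqP; field; rewrite gt_eqF//.
  apply: (le_trans hdelta).
  exact: (le_bigmax _ (fun i : 'I_n => delta_stat (fun j : 'I_n => X j w : 'rV[R]_d) i (s n w i) (B n w i) (k n)) i).
by exists n0 => n nn; exact: hn0.
Qed.
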